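(* There exist constants $D$, $B$, $c>0$ and an infinite family of expander graphs $G$ (finite connected simple graphs with maximum degree at most $D$ and $1/(1-\lambda_2(\mathbf{P}))\le B$), with arbitrarily large number of vertices $n$, such that $\widetilde{\mathsf{VC}}(G)\ge c\,n\log n$ for each graph in the family.
   Context: $\mathbf{P}$ is the simple random walk on $G$ ($\mathbf{P}_{u,v}=1/\deg(u)$ for $\{u,v\}\in E$) and $\lambda_2(\mathbf{P})$ its second largest eigenvalue in absolute value; for bounded-degree graphs the condition $1/(1-\lambda_2(\mathbf{P}))=O(1)$ is equivalent to edge expansion $|E(X,V\setminus X)|=\Omega(|X|)$ for all $X$ with $1\le|X|\le n/2$. Unweighted deterministic walk: each vertex $u$ has a rotor sequence of length $\tilde d(u)$ of neighbours of $u$, each occurring exactly $\tilde d(u)/\deg(u)$ times, and an initial rotor position; the walk moves from the current vertex to the vertex its rotor points at and then advances that rotor cyclically. $\widetilde{\mathsf{VC}}(G)$ is the maximum over start vertices and all rotor sequences/initial positions (lengths fixed) of the least $t$ by which all vertices have been visited. *)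

(* Defs.v *)
From HB Require Import structures.
From mathcomp Require Import all_boot all_order all_algebra.
From mathcomp Require Import polyrcf.
From mathcomp Require Import all_classical all_reals all_analysis.

Set Implicit Arguments.
Unset Strict Implicit.
Unset Printing Implicit Defensive.

Import Order.TTheory GRing.Theory Num.Theory.

Local Open Scope ring_scope.

Record sgraph : Type := SGraph {
  nverts : nat;
  adj : rel 'I_nverts;
  adj_sym : symmetric adj;
  adj_irr : irreflexive adj }.

Definition deg (G : sgraph) (u : 'I_(nverts G)) : nat :=
  #|[set v | adj u v]|.

Definition connected_graph (G : sgraph) : Prop :=
  (0 < nverts G)%N /\ forall u v : 'I_(nverts G), connect (@adj G) u v.

Definition max_degree (G : sgraph) : nat := \max_(u < nverts G) deg u.

Definition srw_mx (R : realType) (G : sgraph) : 'M[R]_(nverts G) :=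
  \matrix_(u, v) if adj u v then (deg u)%:R^-1 else 0.

(* The real eigenvalues, repeated according to algebraic multiplicity.  For
   srw_mx this is the whole spectrum, since the matrix is similar to a
   symmetric one. *)
Definition spectrum (R : realType) (n : nat) (A : 'M[R]_n) : seq R :=
  flatten [seq nseq (mup a (char_poly A)) a | a <- rootsR (char_poly A)].

(* The absolute value of the second entry of the spectrum listed by decreasing
   absolute value; in particular it is 1 on connected bipartite graphs with at
   least two vertices. *)
Definition lambda2 (R : realType) (n : nat) (A : 'M[R]_n) : R :=
  nth 0 (sort (fun x y : R => y <= x) [seq `|a| | a <- spectrum A]) 1.

Section DeterministicWalk.
Variables (G : sgraph).
Local Notation V := 'I_(nverts G).

(* Lengths that admit rotor sequences containing every neighbour of u the same
   positive number dt u / deg u of times. *)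
Definition rotor_lengths (dt : V -> nat) : Prop :=
  forall u : V, (0 < dt u)%N /\ (deg u %| dt u)%N.

Definition rotor_sequences (dt : V -> nat) (s : V -> seq V) : Prop :=
  forall u : V,
    [/\ size (s u) = dt u,
        (forall v : V, v \in s u -> adj u v) &
        (forall v : V, adj u v -> count_mem v (s u) = (dt u %/ deg u)%N)].

Definition rotor_positions (dt : V -> nat) (p : V -> nat) : Prop :=
  forall u : V, (p u < dt u)%N.

(* A state is the current vertex together with the position of every rotor. *)
Definition rotor_step (s : V -> seq V) (x : V * (V -> nat)) : V * (V -> nat) :=
  let: (u, p) := x in
  (nth u (s u) (p u),
   fun v => if v == u then ((p v).+1 %% size (s v))%N else p v).

Definition det_walk (s : V -> seq V) (p : V -> nat) (u0 : V) (t : nat) : V :=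
  (iter t (rotor_step s) (u0, p)).1.

Definition covered_by (s : V -> seq V) (p : V -> nat) (u0 : V) (t : nat) :
  Prop := forall v : V, exists2 i : nat, (i <= t)%N & det_walk s p u0 i = v.

Local Open Scope classical_set_scope.

(* The least t with covered_by s p u0 t (+oo if there were none). *)
Definition cover_time (R : realType) (s : V -> seq V) (p : V -> nat) (u0 : V) :
  \bar R := ereal_inf [set (t%:R)%:E | t in [set t | covered_by s p u0 t]].

(* There are finitely many start vertices, rotor sequences and positions for
   given lengths, so the supremum is a maximum. *)
Definition det_vertex_cover_time (R : realType) (dt : V -> nat) : \bar R :=
  ereal_sup [set x : \bar R | exists (s : V -> seq V) (p : V -> nat) (u0 : V),
    [/\ rotor_sequences dt s, rotor_positions dt p & x = cover_time R s p u0]].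

End DeterministicWalk.

(* Main.v *)
(* The vertices are a binary tree with n leaves and an expander on the leaves, the
   torus (Z/m)^2 with n = m^2 and the edges of Margulis and of Gabber and Galil, to
   which a 4-ary heap is added so that the leaves have radius (log_2 n)/2 while the
   top of the binary tree is at depth log_2 n.  The walk starts at a leaf r, and
   the rotors of the binary tree point to the parent last.

   The time is cut into rounds, in each of which r uses each of its arcs once; no
   arc is then used twice in a round.  Since the rotors delay the walk at every
   level of the binary tree, the top is not visited before round log_2 n.  On the
   other hand the vertices visited in a round have all of their arcs used in each
   of the following rounds, hence after (log_2 n)/2 rounds every round takes at
   least n steps.

   The spectral gap of the torus follows by Fourier transform: a function of mean
   zero of small energy has a power spectrum that is nearly invariant under the two
   shears and carries little mass away from the coordinate axes, whereas the shears
   embed two disjoint copies of each quadrant into itself.  The gap then extends to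
   the tree.  Triangles in the torus bound the smallest eigenvalue away from -1. *)

Require Import Defs.
From HB Require Import structures.
From mathcomp Require Import all_boot all_order all_algebra.
From mathcomp Require Import polyrcf.
From mathcomp Require Import all_classical all_reals all_analysis.
From mathcomp Require Import zify lra.

Set Implicit Arguments.
Unset Strict Implicit.
Unset Printing Implicit Defensive.

Import Order.TTheory GRing.Theory Num.Theory.

(** * Rounds of a deterministic walk *)

(** The quotient grows exactly when [b] is congruent to [j] modulo [d]. Through this closed form the
    uses of an arc depend only on the exits from its tail. *)
Lemma count_residue (d j b : nat) : j < d ->
  \sum_(i < b) (i %% d == j) = (b + (d - j.+1)) %/ d.
Proof.
move=> ltjd; elim: b => [|b IHb].
  by rewrite big_ord0 divn_small //; lia.
rewrite big_ord_recr /= IHb addSn divnS; last by lia.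
rewrite addnC; congr (_ + _); congr nat_of_bool.
have -> : (b + (d - j.+1)).+1 = b + (d - j) by lia.
have d_gt0 : 0 < d by lia.
rewrite {2}(divn_eq b d) -addnA dvdn_addr ?dvdn_mull //.
have ltbd := ltn_pmod b d_gt0.
apply/eqP/idP => [->|/dvdnP [q]]; first by rewrite subnKC // ltnW.
case: q => [|[|q]]; nia.
Qed.

Section RotorWalk.

Variables (V : finType) (o : V -> seq V) (X : nat -> V).
Hypothesis o_uniq : forall u, uniq (o u).
Hypothesis o_gt0 : forall u, 0 < size (o u).
Hypothesis o_sym : forall u v, (u \in o v) = (v \in o u).

Definition exits t v := \sum_(i < t) (X i == v).
Definition arcs t u v := \sum_(i < t) ((X i == u) && (X i.+1 == v)).

(** All rotors start at position 0, so a rotor position is the number of exits so far modulo the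
    degree. *)
Hypothesis X_step :
  forall t, X t.+1 = nth (X t) (o (X t)) (exits t (X t) %% size (o (X t))).

Local Notation d u := (size (o u)).

Lemma exitsS t v : exits t.+1 v = exits t v + (X t == v).
Proof. by rewrite /exits big_ord_recr. Qed.

Lemma exits_mono s t v : s <= t -> exits s v <= exits t v.
Proof.
move=> /subnKC <-; elim: (t - s) => [|i IH]; first by rewrite addn0.
by rewrite addnS exitsS (leq_trans IH) ?leq_addr.
Qed.

Lemma arcsS t u v : arcs t.+1 u v = arcs t u v + ((X t == u) && (X t.+1 == v)).
Proof. by rewrite /arcs big_ord_recr. Qed.

Lemma X_adj t : X t.+1 \in o (X t).
Proof. by rewrite X_step mem_nth // ltn_pmod. Qed.

Lemma arcsE t u v : v \in o u ->
  arcs t u v = (exits t u + (d u - (index v (o u)).+1)) %/ d u.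
Proof.
move=> vu; have ltv : index v (o u) < d u by rewrite index_mem.
rewrite -count_residue //; elim: t => [|t IH].
  by rewrite /arcs /exits !big_ord0.
rewrite arcsS exitsS IH; case: eqP => [Xt|_] /=; last by rewrite !addn0.
rewrite addn1 big_ord_recr /= X_step Xt; congr (_ + nat_of_bool _).
rewrite -{1}(nth_index u vu) nth_uniq ?ltn_pmod //.
Qed.

Lemma arcs_notin t u v : v \notin o u -> arcs t u v = 0.
Proof.
move=> vu; rewrite /arcs big1 // => i _.
case: eqP => //= Xi; case: eqP => //= Xi1.
by move: (X_adj i) vu; rewrite Xi1 Xi => ->.
Qed.

(** A full turn of the rotor at [u] uses each arc out of [u] once. *)
Lemma arcs_le s t u v k : exits t u <= exits s u + d u * k ->
  arcs t u v <= arcs s u v + k.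
Proof.
move=> le_st; have [vu|vu] := boolP (v \in o u); last by rewrite !arcs_notin.
rewrite !arcsE // [leqRHS]addnC -divnMDl //.
by apply: leq_div2r; rewrite mulnC; lia.
Qed.

Lemma arcs_le_exits t u v : arcs t u v <= exits t u.
Proof. by apply: leq_sum => i _; case: (_ == u); case: (_ == v). Qed.

(** Flow conservation: an arrival is followed by an exit unless the walk is still there, and the
    start counts as an arrival. *)
Lemma entries t v :
  \sum_(u <- o v) arcs t u v + (X 0 == v) = exits t v + (X t == v).
Proof.
elim: t => [|t IH].
  by rewrite /exits big_ord0 big1 // => u _; rewrite /arcs big_ord0.
rewrite exitsS -IH.
under eq_bigr => u _ do rewrite arcsS.
rewrite big_split /= -!addnA; congr (_ + _); rewrite addnC; congr (_ + _).
case: (X t.+1 =P v) => [Xv|_]; last first.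
  by rewrite big1 // => u _; rewrite andbF.
have Xt : X t \in o v by rewrite -o_sym -Xv X_adj.
rewrite (bigD1_seq (X t)) //= eqxx big1 // => u /negPf.
by rewrite eq_sym => ->.
Qed.

Lemma arcs_lt_exits s t u v : arcs s u v < arcs t u v ->
  exits s u < exits t u.
Proof.
move=> lt_st; rewrite ltnNge; apply: contraL lt_st => le_ts.
by rewrite -leqNgt -(addn0 (arcs s u v)) arcs_le // muln0 addn0.
Qed.

(* Each of the exits of [u] needs an entry, and the entries come from arcs that
   have been used at most [k] times. *)
Lemma arcs_le_round s t r k : X s = r -> s <= t ->
  exits t r <= exits s r + d r * k ->
  forall u v, arcs t u v <= arcs s u v + k.
Proof.
move=> Xs /subnKC <-; elim: (t - s) => [|i IH] le_r u v.
  by rewrite addn0 leq_addr.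
rewrite addnS in le_r *; set t' := s + i in IH le_r *.
have {}IH := IH (leq_trans (exits_mono r (leqnSn t')) le_r).
have [->|u_r] := eqVneq u r; first exact: arcs_le.
case: (X t' =P u) => [Xu|/eqP/negPf Xu]; last by rewrite arcsS Xu addn0 IH.
apply: arcs_le; rewrite exitsS Xu eqxx.
(* The walk is at [u] at time [t'] but not at time [s], so entries exceed exits by one in between;
   this pays for the exit at [t']. *)
have := entries t' u; have := entries s u; rewrite Xu Xs eqxx [r == u]eq_sym (negPf u_r).
have : \sum_(x <- o u) arcs t' x u <= \sum_(x <- o u) arcs s x u + d u * k.
  rewrite -sum1_size big_distrl -big_split /=.
  by apply: leq_sum => x _; rewrite mul1n; apply: IH.
by lia.
Qed.

Lemma return_time t v m : m < exits t v ->
  exists2 s, s < t & X s = v /\ exits s v = m.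
Proof.
elim: t => [|t IH]; first by rewrite /exits big_ord0.
rewrite exitsS; case: (X t =P v) => [Xt|_] lt_m; last first.
  by have [|s lt_st ?] := IH; [lia | exists s => //; apply: ltnW].
have [lt_mt|le_tm] := ltnP m (exits t v).
  by have [s lt_st ?] := IH lt_mt; exists s => //; apply: ltnW.
by exists t => //; split=> //; lia.
Qed.

(* [k]-th round of [r]: it runs over the times in [s, t). *)
Definition round r k s t :=
  [/\ X s = r, exits s r = d r * k, X t = r & exits t r = d r * k.+1].

Lemma round_lt r k s t : round r k s t -> s < t.
Proof.
case=> _ es _ et; rewrite ltnNge; apply/negP => le_ts.
have := exits_mono r le_ts; rewrite es et mulnS; have := o_gt0 r; lia.
Qed.

Lemma round_arcs_le r k s t : round r k s t ->
  forall u v, arcs t u v <= (arcs s u v).+1.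
Proof.
move=> rd u v; have lt_st := round_lt rd; case: rd => Xs es _ et.
rewrite -addn1; apply: arcs_le_round Xs (ltnW lt_st) _ _ _.
by rewrite es et muln1 mulnS; lia.
Qed.

(** A round is a closed walk, so [v] is entered as often as it is left, at least [d v] times. Each
    of its [d v] incoming arcs is used at most once, hence all are used. *)
Lemma saturated_entries r k s t u v : round r k s t ->
  exits s v + d v <= exits t v -> u \in o v -> arcs s u v < arcs t u v.
Proof.
move=> rd sat uv; have le1 := round_arcs_le rd; case: rd => Xs _ Xt _.
rewrite ltnNge; apply/negP => le_ts.
have := entries t v; have := entries s v; rewrite Xs Xt.
have : \sum_(x <- o v) arcs t x v < \sum_(x <- o v) arcs s x v + d v.
  rewrite -sum1_size -big_split /=.
  rewrite !(bigD1_seq u) //= -addSn leq_add //; first by rewrite addn1 ltnS.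
  by apply: leq_sum => x _; rewrite addn1.
by lia.
Qed.

(* After the first of the two rounds the last-exit arcs of the visited vertices
   form a tree oriented towards [r], and these arcs are last in line for the
   second round.  All arcs into a saturated vertex being used in that round,
   saturation propagates from [r] up this tree. *)
Lemma visited_saturated r k s t t' v : round r k s t -> round r k.+1 t t' ->
  exits s v < exits t v -> exits t v + d v <= exits t' v.
Proof.
move=> rd rd'; have [Xs es Xt et] := rd; have [_ _ Xt' et'] := rd'.
have lt_st := round_lt rd.
have last_exit : forall i y, s <= i -> exits i y < exits t y ->
    exists2 i', i <= i' < t & X i' = y /\ exits t y = (exits i' y).+1.
  move=> i y le_si lt_it; have := @return_time t y (exits t y).-1.
  case=> [|i' lt_i't [Xi' ei']]; first by lia.
  exists i'; last by split=> //; lia.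
  rewrite lt_i't andbT leqNgt; apply/negP => lt_i'i.
  by have := exits_mono y lt_i'i; rewrite exitsS Xi' eqxx; lia.
suff sat n i y : t - i <= n -> s <= i -> i < t -> X i = y ->
    exits t y = (exits i y).+1 -> exits t y + d y <= exits t' y.
  move=> /(last_exit _ _ (leqnn s)) [i /andP[le_si lt_it] [Xi ei]].
  exact: sat (leqnn _) le_si lt_it Xi ei.
elim: n i y => [|n IH] i y; first by lia.
move=> le_n le_si lt_it Xi ei.
have satz : exits t (X i.+1) + d (X i.+1) <= exits t' (X i.+1).
  have [->|z_r] := eqVneq (X i.+1) r; first by rewrite et et' mulnS; lia.
  have lt_i1t : i.+1 < t.
    by rewrite ltn_neqAle lt_it andbT; apply: contraNneq z_r => ->; rewrite Xt.
  have [||i' /andP[le_i' lt_i't] [Xi' ei']] := last_exit i.+1 (X i.+1).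
  - exact: leqW.
  - by apply: leq_trans (exits_mono _ lt_i1t); rewrite [leqRHS]exitsS eqxx addn1.
  by apply: IH Xi' ei'; lia.
have yz : X i.+1 \in o y by rewrite -Xi X_adj.
have := saturated_entries rd' satz; move/(_ y); rewrite o_sym => /(_ yz).
rewrite !arcsE // ei X_step Xi.
(* The last exit from [y] takes the arc at position [p], whose use number is [e.+1]. Another use by
   time [t'] needs [e.+1 * d y + p.+1] exits, which is a full turn beyond [exits t y = q.+1]. *)
set q := exits i y; have := divn_eq q (d y); have := ltn_pmod q (o_gt0 y).
set p := q %% d y; set e := q %/ d y => ltp Eq.
rewrite index_uniq //.
have -> : (q.+1 + (d y - p.+1)) %/ d y = e.+1.
  have -> : q.+1 + (d y - p.+1) = e.+1 * d y by lia.
  by rewrite mulnK.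
by rewrite leq_divRL //; lia.
Qed.

Lemma split_round r t k : X t = r -> exits t r = d r * k.+1 ->
  exists2 s, s < t & round r k s t.
Proof.
move=> Xt et; have [|s lt_st [Xs es]] := @return_time t r (d r * k).
  by rewrite et mulnS; have := o_gt0 r; lia.
by exists s.
Qed.

(** By induction [pa u] is visited in the previous round, hence saturated in this one, which uses
    the arc from [u] to [pa u]. *)
Lemma ball_visited r (pa : V -> V) i u k s t :
  (forall v, pa v = v \/ pa v \in o v) -> iter i pa u = r -> i <= k ->
  round r k s t -> exits s u < exits t u.
Proof.
move=> pa_adj; elim: i u k s t => [|i IH] u k s t /=.
  by move=> -> _ [_ -> _ ->]; rewrite mulnS; have := o_gt0 r; lia.
rewrite -iterS iterSr => iter_u; case: k => // k le_ik rd.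
have [Xs es _ _] := rd.
have [s' _ rd'] := split_round Xs es.
have := IH _ _ _ _ iter_u le_ik rd'.
case: (pa_adj u) => [->|pau] lt_pa.
  by have := visited_saturated rd' rd lt_pa; have := o_gt0 u; lia.
have := saturated_entries rd (visited_saturated rd' rd lt_pa); move/(_ u).
by rewrite o_sym => /(_ pau) /arcs_lt_exits.
Qed.

(** Counting rounds from 0, [u] is visited from round [i] on, and so makes a full turn in each round
    from [i.+1] on. *)
Lemma exits_ball r (pa : V -> V) i u k t :
  (forall v, pa v = v \/ pa v \in o v) -> iter i pa u = r ->
  X t = r -> exits t r = d r * k -> d u * (k - i.+1) <= exits t u.
Proof.
move=> pa_adj iter_u; elim: k t => [|k IH] t Xt et; first by rewrite muln0.
have [s lt_st rd] := split_round Xt et.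
have [Xs es _ _] := rd.
have {IH} := IH _ Xs es.
case: k rd es {et} => [|k] rd es IH; first by rewrite muln0.
have [le_ik|lt_ki] := leqP i k; last first.
  have -> : k.+2 - i.+1 = 0 by lia.
  by rewrite muln0.
have [s' _ rd'] := split_round Xs es.
have := visited_saturated rd' rd (ball_visited pa_adj iter_u le_ik rd').
have -> : k.+2 - i.+1 = (k.+1 - i.+1).+1 by lia.
by rewrite mulnS; lia.
Qed.

Lemma sum_exits t : \sum_v exits t v = t.
Proof.
rewrite exchange_big /= -[RHS]card_ord -sum1_card; apply: eq_bigr => i _.
by rewrite (bigD1 (X i)) //= eqxx big1 // => v /negPf; rewrite eq_sym => ->.
Qed.

(** No arc is used more than [k] times before [k] rounds are complete; by then every vertex of [C]
    has made its share of the exits. *)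
Lemma ball_time r (pa : V -> V) i k (C : pred V) t u v :
  (forall v, pa v = v \/ pa v \in o v) -> (forall x, C x -> iter i pa x = r) ->
  X 0 = r -> k < arcs t u v -> #|C| * (k - i.+1) <= t.
Proof.
move=> pa_adj iterC X0 lt_k.
have [|s lt_st [Xs es]] := @return_time t r (d r * k).
  rewrite ltnNge; apply: contraL lt_k => le_r; rewrite -leqNgt.
  have := @arcs_le_round 0 t r k X0 isT _ u v.
  have -> : exits 0 r = 0 by exact: big_ord0.
  have -> : arcs 0 u v = 0 by exact: big_ord0.
  exact.
apply: leq_trans (ltnW lt_st); rewrite -[leqRHS]sum_exits -sum_nat_const.
rewrite [leqRHS](bigID C) /=; apply: leq_trans (leq_addr _ _).
apply: leq_sum => x /iterC iterx.
apply: leq_trans (exits_ball pa_adj iterx Xs es).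
by rewrite leq_pmull.
Qed.

(* [tp] and [h] are the parent and depth functions of a tree with internal
   vertices [I] and hidden vertex [w] on top.  At the first time when an internal
   vertex [p] starts its last exit of round [h p], it has been entered less than
   [h p] times from its parent, hence more than [h p] times from a child, which
   cannot be internal. *)
Lemma hidden_delay (h : V -> nat) (tp : V -> V) (I : pred V) (w : V) t :
  (forall p, I p -> [/\ d p = 3, index (tp p) (o p) = 2 & 0 < h p]) ->
  (forall p, I p -> tp p = w \/ I (tp p) /\ (h (tp p)).+1 = h p) ->
  (forall p u, I p -> u \in o p -> u != tp p -> h u = (h p).+1 /\ tp u = p) ->
  (forall u, u \in o w -> [/\ I u, h u = 1 & tp u = w]) ->
  ~~ I (X 0) -> X 0 != w -> X t = w ->
  exists s c p,
    [/\ s <= t, I p, c \in o p, c != tp p & ~~ I c /\ h c <= arcs s c p].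
Proof.
move=> Id Itp Ichild ow IX0 X0w Xt.
have tp_in p : I p -> tp p \in o p.
  by case/Id=> dp ip _; rewrite -index_mem ip dp.
have arcs_tp s p : I p -> arcs s p (tp p) = exits s p %/ 3.
  by move=> Ip; rewrite arcsE ?tp_in //; have [-> -> _] := Id p Ip; rewrite addn0.
(* The parent is third in the order, so [3 * h p] exits are what it takes to use the arc to the
   parent [h p] times. *)
pose late s := [exists p, I p && (3 * h p <= exits s p)].
have late_w s : X s = w -> late s.
  case: s => [Xs|s Xs]; first by rewrite Xs eqxx in X0w.
  have := X_adj s; rewrite Xs o_sym => /ow [Iu hu tpu].
  apply/existsP; exists (X s); rewrite Iu hu muln1 /=.
  have := arcs_tp s.+1 _ Iu; rewrite tpu arcsS eqxx Xs eqxx addn1.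
  by case: (ltnP (exits s.+1 (X s)) 3) => // ?; rewrite divn_small.
have ex_late : exists s, late s by exists t; apply: late_w.
case: (ex_minnP ex_late) => -[|s] late_s min_s.
  case/existsP: late_s => p /andP[/Id [_ _ h_gt0]].
  by have -> : exits 0 p = 0 by [exact: big_ord0]; lia.
have early p : I p -> exits s p < 3 * h p.
  move=> Ip; rewrite ltnNge; apply/negP => late_p.
  suff /min_s : late s by rewrite ltnn.
  by apply/existsP; exists p; rewrite Ip.
have le_st : s <= t by apply: ltnW; apply: min_s; apply: late_w.
case/existsP: late_s => p /andP[Ip]; rewrite exitsS.
have := early p Ip; case: (X s =P p) => [Xs|_] lt_p le_p; last by lia.
case: (pickP (fun c => [&& c \in o p, c != tp p, ~~ I c & h c <= arcs s c p])).
  by move=> c /and4P[? ? ? ?]; exists s, c, p.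
move=> no_c; have [dp _ hp] := Id p Ip.
have := entries s p; rewrite Xs eqxx.
have -> : X 0 == p = false by apply: contraNF IX0 => /eqP ->.
(* The parent contributes less than [h p] and each of the two children at most [h p], while [p] was
   entered [3 * h p] times. *)
suff : \sum_(u <- o p) arcs s u p < 3 * h p by lia.
rewrite -dp -sum1_size big_distrl /= (bigD1_seq (tp p)) ?tp_in //=.
rewrite [ltnRHS](bigD1_seq (tp p)) ?tp_in //= -addSn leq_add //.
  rewrite mul1n -ltnS.
  have [->|[Iq <-]] := Itp p Ip; last first.
    rewrite ltnS ltnS; have := @arcs_le 0 s (tp p) p (h (tp p)).
    have -> : arcs 0 (tp p) p = 0 by exact: big_ord0.
    have -> : exits 0 (tp p) = 0 by exact: big_ord0.
    by apply; have [-> _ _] := Id _ Iq; have := early _ Iq; lia.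
  rewrite ltnS; apply: leq_ltn_trans hp; apply: leq_trans (arcs_le_exits _ _ _) _.
  rewrite leqNgt; apply/negP => /return_time [i lt_is [/late_w /min_s]].
  by lia.
rewrite !(big_seq_cond (fun u => u != tp p)); apply: leq_sum => u /andP[up utp].
have [hu tpu] := Ichild p u Ip up utp.
rewrite mul1n; case: (boolP (I u)) => [Iu|nIu].
  by have := arcs_tp s u Iu; rewrite tpu => ->; rewrite -ltnS ltn_divLR // mulnC -hu early.
by have := no_c u; rewrite up utp nIu /= hu => /negbT; rewrite -leqNgt.
Qed.

End RotorWalk.

(** * Rotor sequences made of copies of one order *)

Lemma size_flatten_nseq (T : Type) k (s : seq T) :
  size (flatten (nseq k s)) = k * size s.
Proof. by elim: k => //= k IH; rewrite size_cat IH mulSn. Qed.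

Lemma nth_flatten_nseq (T : Type) (x : T) k (s : seq T) i :
  i < k * size s -> nth x (flatten (nseq k s)) i = nth x s (i %% size s).
Proof.
elim: k i => //= k IH i; rewrite nth_cat mulSn => lt_i.
have [lt_is|le_i] := ltnP i (size s); first by rewrite modn_small.
rewrite IH; last by lia.
by rewrite -{2}(subnK le_i) modnDr.
Qed.

Section CopiedOrder.

Variables (G : sgraph) (o : 'I_(nverts G) -> seq 'I_(nverts G)).
Hypothesis o_uniq : forall u, uniq (o u).
Hypothesis mem_o : forall u v, (v \in o u) = adj u v.
Variable dt : 'I_(nverts G) -> nat.
Hypothesis dt_lengths : rotor_lengths dt.

Definition copies u := flatten (nseq (dt u %/ deg u) (o u)).

Lemma size_o u : size (o u) = deg u.
Proof.
by rewrite -(card_uniqP (o_uniq u)); apply: eq_card => v; rewrite inE mem_o.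
Qed.

Lemma size_copies u : size (copies u) = dt u.
Proof.
by rewrite size_flatten_nseq size_o divnK //; case: (dt_lengths u).
Qed.

Lemma copies_rotor_sequences : rotor_sequences dt copies.
Proof.
move=> u; split=> [|v|v]; first exact: size_copies.
  by case/flattenP=> s /nseqP[-> _]; rewrite mem_o.
rewrite -mem_o => vu; rewrite count_flatten map_nseq sumn_nseq.
by rewrite (count_uniq_mem _ (o_uniq u)) vu mul1n.
Qed.

(** As [deg u] divides [dt u], a position modulo [dt u] in the copies points to the same neighbour
    as the exit count modulo [deg u] in a single copy. The walk is thus the same for all rotor
    lengths. *)
Lemma det_walk_copies u0 (X := det_walk copies (fun=> 0) u0) t :
  X t.+1 = nth (X t) (o (X t)) (exits X t (X t) %% size (o (X t))).
Proof.
have pos v : (iter t (rotor_step copies) (u0, fun=> 0)).2 v =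
    exits X t v %% dt v.
  elim: t => [|t IH]; first by rewrite /exits big_ord0 mod0n.
  rewrite exitsS iterS /X /det_walk; move: IH.
  case: (iter t _ _) => u p /= IH; rewrite eq_sym.
  by case: eqP => _; rewrite ?addn0 // size_copies IH -[(_ %% _).+1]addn1 modnDml.
rewrite {1}/X /det_walk iterS; move: pos; rewrite /X /det_walk.
case: (iter t _ _) => u p /= -> .
have [dt_gt0 dvd] := dt_lengths u.
rewrite nth_flatten_nseq size_o; last by rewrite divnK // ltn_pmod.
by rewrite modn_dvdm.
Qed.

End CopiedOrder.

Local Open Scope ring_scope.

(** * Spectral gap of the torus *)

Section Torus.

Variables (R : realType) (M : nat).
Local Notation Z := 'I_M.+2.

Definition angle (t : nat) : R := t%:R / M.+2%:R * (pi *+ 2).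
(** Real and imaginary parts of a character of Z/m, which keep the Fourier analysis over [R]. *)
Definition cosZ (t : Z) : R := cos (angle t).
Definition sinZ (t : Z) : R := sin (angle t).

Lemma angleD s t : angle (s + t) = angle s + angle t.
Proof. by rewrite /angle natrD !mulrDl. Qed.

Lemma angle_period : angle M.+2 = pi *+ 2.
Proof. by rewrite /angle divff ?pnatr_eq0 // mul1r. Qed.

Lemma angle_addZ (s t : Z) :
  angle (s + t)%R = angle s + angle t \/
  angle (s + t)%R + pi *+ 2 = angle s + angle t.
Proof.
rewrite -angle_period -!angleD /=.
have [lt_st|le_ts] := ltnP (s + t) M.+2; first by left; rewrite modn_small.
right; congr angle; have := ltn_ord s; have := ltn_ord t => lt_t lt_s.
by rewrite -{1}(subnK le_ts) modnDr modn_small; lia.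
Qed.

Lemma cosZD s t : cosZ (s + t) = cosZ s * cosZ t - sinZ s * sinZ t.
Proof.
by rewrite /cosZ /sinZ -cosD; have [->//|<-] := angle_addZ s t; rewrite cosD2pi.
Qed.

Lemma sinZD s t : sinZ (s + t) = sinZ s * cosZ t + cosZ s * sinZ t.
Proof.
by rewrite /cosZ /sinZ -sinD; have [->//|<-] := angle_addZ s t; rewrite sinD2pi.
Qed.

Lemma cos2Dsin2Z t : cosZ t ^+ 2 + sinZ t ^+ 2 = 1.
Proof. exact: cos2Dsin2. Qed.

Lemma cosZ0 : cosZ 0 = 1.
Proof. by rewrite /cosZ /angle !mul0r cos0. Qed.

Lemma sinZ0 : sinZ 0 = 0.
Proof. by rewrite /sinZ /angle !mul0r sin0. Qed.

Lemma cosZB s t : cosZ (s - t) = cosZ s * cosZ t + sinZ s * sinZ t.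
Proof.
rewrite -{2 3}(subrK t s); move: (s - t) => u; rewrite cosZD sinZD.
by rewrite -[LHS]mulr1 -(cos2Dsin2Z t); lra.
Qed.

Lemma sinZB s t : sinZ (s - t) = sinZ s * cosZ t - cosZ s * sinZ t.
Proof.
rewrite -{2 3}(subrK t s); move: (s - t) => u; rewrite cosZD sinZD.
by rewrite -[LHS]mulr1 -(cos2Dsin2Z t); lra.
Qed.

Lemma cos_itv_pi2_3pi2 (x : R) : pi / 2 <= x -> x <= pi / 2 + pi -> cos x <= 0.
Proof.
move=> x1 x2; rewrite -[x](subrK pi) cosDpi oppr_le0 cos_ge0_pihalf //.
by apply/andP; split; lra.
Qed.

Lemma cosZ_le0 (t : Z) : (M.+2 <= 4 * t)%N -> (4 * t <= 3 * M.+2)%N ->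
  cosZ t <= 0.
Proof.
move=> t1 t2; have pi0 := pi_gt0 R.
have m0 : 0 < M.+2%:R :> R by rewrite ltr0n.
have {}t1 : M.+2%:R <= 4 * t%:R :> R by rewrite -natrM ler_nat.
have {}t2 : 4 * t%:R <= 3 * M.+2%:R :> R by rewrite -!natrM ler_nat.
rewrite /cosZ /angle; set m : R := M.+2%:R in m0 t1 t2 *; set x : R := t%:R in t1 t2 *.
have e1 : 1 / 4 <= x / m by rewrite ler_pdivlMr //; lra.
have e2 : x / m <= 3 / 4 by rewrite ler_pdivrMr //; lra.
rewrite mulr2n mulrDr; move: (x / m) e1 e2 => y e1 e2.
apply: cos_itv_pi2_3pi2.
  by have := ler_wpM2r (ltW pi0) e1; lra.
by have := ler_wpM2r (ltW pi0) e2; lra.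
Qed.

Lemma cosZ_neq1 (t : Z) : t != 0 -> cosZ t != 1.
Proof.
move=> t0; have pi0 := pi_gt0 R.
have m0 : 0 < M.+2%:R :> R by rewrite ltr0n.
have tm : t%:R < M.+2%:R :> R by rewrite ltr_nat.
have {t0}t_gt0 : 0 < t%:R :> R by rewrite ltr0n lt0n.
have e1 : 0 < t%:R / M.+2%:R :> R by rewrite divr_gt0.
have e2 : t%:R / M.+2%:R < 1 :> R by rewrite ltr_pdivrMr // mul1r.
rewrite /cosZ /angle; set y := _ / _ in e1 e2 *.
have -> : y * (pi *+ 2) = (y * pi) *+ 2 by rewrite mulrnAr.
rewrite cos_mulr2n -subr_eq0.
have -> : cos (y * pi) ^+ 2 *+ 2 - 1 - 1 = - (sin (y * pi) ^+ 2 *+ 2) :> R.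
  by rewrite -[in RHS](addrK (cos (y * pi) ^+ 2) (sin _ ^+ 2)) addrC sin2cos2; lra.
rewrite oppr_eq0 mulrn_eq0 /= expf_eq0 /= gt_eqF // sin_gt0_pi //.
have := ltr_pM2r pi0 0 y; have := ltr_pM2r pi0 y 1.
by rewrite mul0r mul1r e1 e2 => -> ->.
Qed.

Local Notation K := (Z * Z)%type.

Definition dot (k z : K) : Z := k.1 * z.1 + k.2 * z.2.

Lemma dotDl k l z : dot (k + l) z = dot k z + dot l z.
Proof. by rewrite /dot /= !mulrDl addrACA. Qed.

Lemma dotBr k y z : dot k (y - z) = dot k y - dot k z.
Proof. by rewrite /dot /= !mulrBr opprD addrACA. Qed.

(** Translating [k] by [e] multiplies the complex character sum [A + i B] by a number of modulus 1
    other than 1. *)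
Lemma sum_cos_dot (w : K) : w != 0 -> \sum_(k : K) cosZ (dot k w) = 0.
Proof.
move=> w0; have [e e0] : exists e : K, dot e w != 0.
  have [w1|w1] := eqVneq w.1 0; last first.
    by exists (1, 0); rewrite /dot /= mul1r mul0r addr0.
  exists (0, 1); rewrite /dot /= mul1r mul0r add0r.
  by apply: contraNneq w0 => w2; rewrite [w]surjective_pairing w1 w2.
set A := LHS; pose B := \sum_(k : K) sinZ (dot k w).
have c1 := cosZ_neq1 e0; have cs := cos2Dsin2Z (dot e w).
have EA : A = A * cosZ (dot e w) - B * sinZ (dot e w).
  rewrite {1}/A (reindex_inj (addIr e)) /= !mulr_suml -sumrB.
  by apply: eq_bigr => k _; rewrite dotDl cosZD.
have EB : B = B * cosZ (dot e w) + A * sinZ (dot e w).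
  rewrite {1}/B (reindex_inj (addIr e)) /= !mulr_suml -big_split.
  by apply: eq_bigr => k _; rewrite dotDl sinZD.
move: (cosZ _) (sinZ _) c1 cs EA EB => c s c1 cs EA EB.
(* Eliminating [B] leaves [A] times [(1 - c) ^+ 2 + s ^+ 2], which equals [(1 - c) *+ 2]. *)
have : A * (1 - c) *+ 2 = 0.
  have -> : A * (1 - c) *+ 2 = A * ((1 - c) ^+ 2 + (c ^+ 2 + s ^+ 2 - c ^+ 2)).
    by rewrite cs; lra.
  have h1 : A * (1 - c) = - (B * s) by rewrite mulrBr mulr1 {1}EA; lra.
  have h2 : B * (1 - c) = A * s by rewrite mulrBr mulr1 {1}EB; lra.
  have -> : A * ((1 - c) ^+ 2 + (c ^+ 2 + s ^+ 2 - c ^+ 2)) =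
    (A * (1 - c)) * (1 - c) + (A * s) * s by lra.
  by rewrite h1 -h2; lra.
move/eqP; rewrite mulrn_eq0 /= mulf_eq0 subr_eq0 [1 == c]eq_sym (negPf c1) orbF.
by move/eqP.
Qed.

(** The two parts of a Fourier coefficient; [power] is its squared modulus, and [power_dist] that of
    a difference of two coefficients. *)
Definition fcos (g : K -> R) k := \sum_z g z * cosZ (dot k z).
Definition fsin (g : K -> R) k := \sum_z g z * sinZ (dot k z).
Definition power (g : K -> R) k := fcos g k ^+ 2 + fsin g k ^+ 2.

Lemma parseval g : \sum_k power g k = (M.+2 ^ 2)%:R * \sum_z g z ^+ 2.
Proof.
have -> : \sum_k power g k =
    \sum_z \sum_y \sum_k g z * g y * cosZ (dot k (z - y)).
  transitivity (\sum_k \sum_z \sum_y g z * g y * cosZ (dot k (z - y))).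
    apply: eq_bigr => k _; rewrite /power !expr2 {1}/fcos {1}/fsin.
    rewrite !mulr_suml -big_split; apply: eq_bigr => z _ /=.
    rewrite !mulr_sumr -big_split; apply: eq_bigr => y _ /=.
    by rewrite dotBr cosZB; lra.
  by rewrite exchange_big; apply: eq_bigr => z _; rewrite exchange_big.
rewrite mulr_sumr; apply: eq_bigr => z _.
rewrite (bigD1 z) //= [X in _ + X]big1 ?addr0; last first.
  by move=> y yz; rewrite -mulr_sumr sum_cos_dot ?mulr0 // subr_eq0 eq_sym.
under eq_bigr => k _.
  rewrite subrr /dot /= !mulr0 addr0 cosZ0 mulr1.
  over.
rewrite sumr_const card_prod !card_ord -mulnn -expr2 mulr_natl.
by [].
Qed.

Definition power_dist (g : K -> R) k l :=
  (fcos g k - fcos g l) ^+ 2 + (fsin g k - fsin g l) ^+ 2.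

Lemma power_ge0 g k : 0 <= power g k.
Proof. by rewrite addr_ge0 ?sqr_ge0. Qed.

Lemma power_dist_ge0 g k l : 0 <= power_dist g k l.
Proof. by rewrite addr_ge0 ?sqr_ge0. Qed.

Lemma power_distC g k l : power_dist g k l = power_dist g l k.
Proof. by rewrite /power_dist; lra. Qed.

(** What matters is 7/5 < 2: one step along a shear loses less than the two disjoint shear images
    gain. *)
Lemma power_le_dist g k l :
  5 * power g k <= 7 * power g l + 18 * power_dist g k l.
Proof.
rewrite /power /power_dist.
move: (fcos g k) (fsin g k) (fcos g l) (fsin g l) => a b c d.
rewrite -subr_ge0; have -> : 7 * (c ^+ 2 + d ^+ 2) +
    18 * ((a - c) ^+ 2 + (b - d) ^+ 2) - 5 * (a ^+ 2 + b ^+ 2) =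
  13^-1 * ((13 * a - 18 * c) ^+ 2 + c ^+ 2 +
           ((13 * b - 18 * d) ^+ 2 + d ^+ 2)) by lra.
by rewrite mulr_ge0 ?invr_ge0 ?ler0n // !addr_ge0 ?sqr_ge0.
Qed.

(** With [s'] the transpose of [s], the coefficient of [g] composed with [s] at [s' k] is that of
    [g] at [k]; Parseval concludes. *)
Lemma energy_linear g (s s' : K -> K) : injective s -> injective s' ->
  (forall k z, dot (s' k) z = dot k (s z)) ->
  \sum_k power_dist g k (s' k) =
  (M.+2 ^ 2)%:R * \sum_z (g (s z) - g z) ^+ 2.
Proof.
move=> inj_s inj_s' s's; rewrite -parseval [RHS](reindex_inj inj_s').
apply: eq_bigr => k _; rewrite /power_dist /power /fcos /fsin.
congr (_ ^+ 2 + _ ^+ 2); rewrite (reindex_inj inj_s) -sumrB;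
  by apply: eq_bigr => z _; rewrite s's mulrBl.
Qed.

(** Translation multiplies each coefficient by a character value, whose squared distance to 1 is
    [(1 - c) *+ 2]. *)
Lemma energy_translation g e :
  \sum_k (1 - cosZ (dot k e)) *+ 2 * power g k =
  (M.+2 ^ 2)%:R * \sum_(z : K) (g (z + e) - g z) ^+ 2.
Proof.
rewrite -parseval; apply: eq_bigr => k _; rewrite /power.
have shift (z : K) : dot k z = dot k (z + e) - dot k e.
  by rewrite -dotBr addrK.
have -> : fcos (fun z : K => g (z + e) - g z) k =
    cosZ (dot k e) * fcos g k + sinZ (dot k e) * fsin g k - fcos g k.
  rewrite /fcos /fsin !mulr_sumr -big_split [X in _ = X - _](reindex_inj (addIr e)) /= -sumrB.
  by apply: eq_bigr => z _; rewrite mulrBl {1}shift cosZB; lra.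
have -> : fsin (fun z : K => g (z + e) - g z) k =
    cosZ (dot k e) * fsin g k - sinZ (dot k e) * fcos g k - fsin g k.
  rewrite /fcos /fsin !mulr_sumr -sumrB [X in _ = X - _](reindex_inj (addIr e)) /= -sumrB.
  by apply: eq_bigr => z _; rewrite mulrBl {1}shift sinZB; lra.
have := cos2Dsin2Z (dot k e).
move: (cosZ _) (sinZ _) (fcos _ _) (fsin _ _) => c s a b cs.
have -> : (1 - c) *+ 2 = c ^+ 2 + s ^+ 2 + 1 - c *+ 2 by rewrite cs; lra.
by lra.
Qed.

Definition up1 (k : K) : K := (k.1, k.1 + k.2).
Definition up2 (k : K) : K := (k.1 + k.2, k.2).
Definition down1 (k : K) : K := (k.1, k.2 - k.1).
Definition down2 (k : K) : K := (k.1 - k.2, k.2).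

Lemma up1K : cancel up1 down1.
Proof. by case=> a b; rewrite /up1 /down1 /= addrC addKr. Qed.
Lemma down1K : cancel down1 up1.
Proof. by case=> a b; rewrite /up1 /down1 /= addrC subrK. Qed.
Lemma up2K : cancel up2 down2.
Proof. by case=> a b; rewrite /up2 /down2 /= addrK. Qed.
Lemma down2K : cancel down2 up2.
Proof. by case=> a b; rewrite /up2 /down2 /= subrK. Qed.

Lemma dot_up1 k z : dot (up1 k) z = dot k (up2 z).
Proof. by rewrite /dot /= mulrDl mulrDr addrA. Qed.
Lemma dot_up2 k z : dot (up2 k) z = dot k (up1 z).
Proof. by rewrite /dot /= mulrDl mulrDr -!addrA. Qed.

Variable q : nat.
Hypothesis q4 : (4 * q)%N = M.+2.

(** Coordinates below [q] lie in the first quarter of the circle; [far] asks for a coordinate in the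
    two middle quarters, where the cosine is at most 0. Unlike [open_box], [box] contains the
    half-axes. *)
Definition open_box (k : K) := (0 < k.1 < q)%N && (0 < k.2 < q)%N.
Definition box (k : K) := [&& k != 0, (k.1 < q)%N & (k.2 < q)%N].
Definition far (k : K) := (q <= k.1 <= 3 * q)%N || (q <= k.2 <= 3 * q)%N.

Lemma val_sub_small (s t : Z) : ((s - t)%R < q)%N -> (t < q)%N ->
  s = ((s - t)%R + t)%N :> nat.
Proof.
move: (s - t) (subrK t s) => u <- u_q t_q /=.
by rewrite modn_small //; lia.
Qed.

(* The positive quadrant is a union of binary trees under the two shears, as the
   images of the shears are disjoint. *)
Lemma down_open_box k : (open_box (down1 k) + open_box (down2 k) <=
  (open_box k || far k))%N.
Proof.
case: k => a b; rewrite /open_box /far /down1 /down2 /fst /snd.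
move: (@val_sub_small b a) (@val_sub_small a b).
move: (nat_of_ord (b - a)) (nat_of_ord (a - b)) => x y hx hy.
case: (boolP (_ && _)) => [/andP[/andP[a0 aq] /andP[x0 xq]]|_];
  case: (boolP (_ && _)) => [/andP[/andP[y0 yq] /andP[b0 bq]]|_] //.
- by have := hx xq aq; have := hy yq bq; lia.
- by have := hx xq aq; lia.
- by have := hy yq bq; lia.
Qed.

(** Let P, F, W be the sums over the open quadrant, over [far], and of the errors. Climbing by both
    shears gives 10 P <= 7 (P + F) + 18 W, so 3 P <= 7 F + 18 W. The two half-axes climb into the
    open quadrant, 5 (A1 + A2) <= 14 P + 18 W, whence 15 (P + A1 + A2) <= 57 P + 54 W. *)
Lemma quadrant_bound (G W1 W2 : K -> R) :
  (forall k, 0 <= G k) -> (forall k, 0 <= W1 k) -> (forall k, 0 <= W2 k) ->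
  (forall k, 5 * G k <= 7 * G (up1 k) + 18 * W1 k) ->
  (forall k, 5 * G k <= 7 * G (up2 k) + 18 * W2 k) ->
  15 * (\sum_(k | box k) G k) <=
  133 * (\sum_(k | far k) G k) + 396 * (\sum_k (W1 k + W2 k)).
Proof.
move=> G0 W10 W20 G1 G2.
have sum_le (P Q : pred K) (F : K -> R) : (forall k, 0 <= F k) ->
    (forall k, P k -> Q k) -> \sum_(k | P k) F k <= \sum_(k | Q k) F k.
  move=> F0 PQ; rewrite big_mkcond [leRHS]big_mkcond /=; apply: ler_sum => k _.
  by case: ifP => [/PQ ->//|_]; case: ifP.
have climb (P : pred K) u W : (forall k, 0 <= W k) ->
    (forall k, 5 * G k <= 7 * G (u k) + 18 * W k) ->
    5 * (\sum_(k | P k) G k) <=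
    7 * (\sum_(k | P k) G (u k)) + 18 * (\sum_k W k).
  move=> W0 GW; apply: (@le_trans _ _
      (7 * (\sum_(k | P k) G (u k)) + 18 * (\sum_(k | P k) W k))).
    by rewrite !mulr_sumr -big_split; apply: ler_sum => k _; apply: GW.
  by rewrite lerD2l ler_wpM2l ?sum_le.
have S1 (P : pred K) : \sum_(k | P k) G (up1 k) = \sum_(k | P (down1 k)) G k.
  by rewrite (reindex_inj (can_inj down1K)); apply: eq_bigr => k _; rewrite down1K.
have S2 (P : pred K) : \sum_(k | P k) G (up2 k) = \sum_(k | P (down2 k)) G k.
  by rewrite (reindex_inj (can_inj down2K)); apply: eq_bigr => k _; rewrite down2K.
have open_le : \sum_(k | open_box k) G (up1 k) + \sum_(k | open_box k) G (up2 k)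
    <= \sum_(k | open_box k) G k + \sum_(k | far k) G k.
  rewrite S1 S2 !(big_mkcond open_box) !(big_mkcond (fun k => open_box _)).
  rewrite (big_mkcond far) -!big_split; apply: ler_sum => k _ /=.
  move: (G k) (G0 k) (down_open_box k) => g g0.
  by case: (open_box (down1 k)); case: (open_box (down2 k));
    case: (open_box k); case: (far k) => //= _; lra.
pose ax1 (k : K) := (k.1 == 0) && (0 < k.2 < q)%N.
pose ax2 (k : K) := (0 < k.1 < q)%N && (k.2 == 0).
have le_ax1 : \sum_(k | ax1 k) G (up2 k) <= \sum_(k | open_box k) G k.
  rewrite S2; apply: sum_le => // -[a b]; rewrite /ax1 /open_box /down2 /=.
  by rewrite subr_eq0 => /andP[/eqP -> ->].
have le_ax2 : \sum_(k | ax2 k) G (up1 k) <= \sum_(k | open_box k) G k.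
  rewrite S1; apply: sum_le => // -[a b]; rewrite /ax2 /open_box /down1 /=.
  by rewrite subr_eq0 => /andP[h /eqP ->]; rewrite h.
have box_le : \sum_(k | box k) G k <= \sum_(k | open_box k) G k +
    (\sum_(k | ax1 k) G k + \sum_(k | ax2 k) G k).
  rewrite (big_mkcond box) (big_mkcond open_box) (big_mkcond ax1).
  rewrite (big_mkcond ax2) -!big_split; apply: ler_sum => -[a b] _ /=.
  have := G0 (a, b); rewrite /box /open_box /ax1 /ax2 /=.
  move: (G _) => g g0; have -> : ((a, b) != 0) = (a != 0) || (b != 0).
    by rewrite -negb_and.
  rewrite -!val_eqE /= -!lt0n.
  have q0 : (0 < q)%N by lia.
  by case: (posnP a) => [->|a0]; case: (posnP b) => [->|b0];
    case: (a < q)%N; case: (b < q)%N; rewrite /= ?q0 ?eqxx ?addr0 ?add0r.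
have := climb open_box up1 W1 W10 G1; have := climb open_box up2 W2 W20 G2.
have := climb ax1 up2 W2 W20 G2; have := climb ax2 up1 W1 W10 G1.
rewrite big_split /=.
have : 0 <= \sum_k W1 k by apply: sumr_ge0.
have : 0 <= \sum_k W2 k by apply: sumr_ge0.
move: (\sum_(k | box k) _) (\sum_(k | open_box k) G k) (\sum_(k | far k) _)
  (\sum_(k | ax1 k) G k) (\sum_(k | ax2 k) G k) open_le le_ax1 le_ax2 box_le.
move=> B P F A1 A2.
move: (\sum_k W1 k) (\sum_k W2 k) (\sum_(k | ax1 k) _) (\sum_(k | ax2 k) _)
  (\sum_(k | open_box k) G (up1 k)) (\sum_(k | open_box k) _).
by move=> *; lra.
Qed.

Definition flip (e : bool * bool) (k : K) : K :=
  (if e.1 then - k.1 else k.1, if e.2 then - k.2 else k.2).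

Lemma flipK e : involutive (flip e).
Proof. by case: e => -[] [] [a b]; rewrite /flip /= ?opprK. Qed.

(** Changing both signs or none commutes with a shear; changing one conjugates it to its inverse.
    The pairs linked by the shear are permuted, up to orientation. *)
Lemma flip_up1 e k : if e.1 == e.2 then flip e (up1 k) = up1 (flip e k)
  else up1 (flip e (up1 k)) = flip e k.
Proof.
case: e k => -[] [] [a b]; rewrite /flip /up1 /= ?opprD //.
  by rewrite addKr.
by rewrite addNKr.
Qed.

Lemma flip_up2 e k : if e.1 == e.2 then flip e (up2 k) = up2 (flip e k)
  else up2 (flip e (up2 k)) = flip e k.
Proof.
case: e k => -[] [] [a b]; rewrite /flip /up2 /= ?opprD //.
  by rewrite subrK.
by rewrite addrK.
Qed.

Lemma sum_flip_dist f (u : K -> K) e : injective u ->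
  (forall k, if e.1 == e.2 then flip e (u k) = u (flip e k)
             else u (flip e (u k)) = flip e k) ->
  \sum_k power_dist f (flip e k) (flip e (u k)) =
  \sum_k power_dist f k (u k).
Proof.
move=> inj_u flip_u; have inj_flip := inv_inj (flipK e).
case: eqP flip_u => _ flip_u.
  by rewrite [RHS](reindex_inj inj_flip); apply: eq_bigr => k _; rewrite flip_u.
rewrite [RHS](reindex_inj (inj_comp inj_flip inj_u)).
by apply: eq_bigr => k _; rewrite /= flip_u power_distC.
Qed.

Lemma opp_middle (a : Z) : (q <= (- a)%R <= 3 * q)%N = (q <= a <= 3 * q)%N.
Proof.
rewrite /=; case: (posnP a) => [->|a0]; first by rewrite subn0 modnn.
by rewrite modn_small; have := ltn_ord a; lia.
Qed.

Lemma opp_small (a : Z) : ~~ (q <= a <= 3 * q)%N -> ~~ (a < q)%N ->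
  ((- a)%R < q)%N.
Proof.
by move=> h1 h2; rewrite /= modn_small; have := ltn_ord a; lia.
Qed.

Lemma far_flip e k : far (flip e k) = far k.
Proof.
by case: e k => -[] [] [a b]; rewrite /far /flip /fst /snd ?opp_middle.
Qed.

Lemma flip_box k : k != 0 -> ~~ far k -> exists e, box (flip e k).
Proof.
case: k => a b k0; rewrite /far negb_or => /andP[ha hb].
exists (~~ (a < q)%N, ~~ (b < q)%N); apply/and3P; split.
- by rewrite -(inj_eq (inv_inj (flipK (~~ (a < q)%N, ~~ (b < q)%N)))) flipK
    /flip /= oppr0 !if_same.
- by rewrite /flip /fst /snd; case: ifPn => [/(opp_small ha)//|/negPn].
- by rewrite /flip /fst /snd; case: ifPn => [/(opp_small hb)//|/negPn].
Qed.

(** At a far frequency one of the two multipliers [(1 - cosZ _) *+ 2] is at least 2. *)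
Lemma far_bound g : (\sum_(k | far k) power g k) *+ 2 <=
  (M.+2 ^ 2)%:R * (\sum_(z : K) (g (z + (1, 0)) - g z) ^+ 2 +
                   \sum_(z : K) (g (z + (0, 1)) - g z) ^+ 2).
Proof.
rewrite mulrDr -!energy_translation -sumrMnl -big_split big_mkcond /=.
apply: ler_sum => k _.
have -> : dot k (1, 0) = k.1 by rewrite /dot /= mulr1 mulr0 addr0.
have -> : dot k (0, 1) = k.2 by rewrite /dot /= mulr1 mulr0 add0r.
have c1 : cosZ k.1 <= 1 by exact: cos_le1.
have c2 : cosZ k.2 <= 1 by exact: cos_le1.
have := power_ge0 g k; rewrite /far; move: (power g k) => p p0.
case: ifP => [/orP[]/andP[h1 h2]|_]; last first.
- by rewrite addr_ge0 // mulr_ge0 // mulrn_wge0 // subr_ge0.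
- have c0 : cosZ k.2 <= 0 by apply: cosZ_le0; rewrite -?q4; lia.
  by rewrite -mulr_natl; nra.
have c0 : cosZ k.1 <= 0 by apply: cosZ_le0; rewrite -?q4; lia.
by rewrite -mulr_natl; nra.
Qed.

(* The estimate of Margulis and of Gabber and Galil. *)
Lemma torus_gap (f : K -> R) : \sum_z f z = 0 ->
  \sum_z f z ^+ 2 <= 106 *
    (\sum_(z : K) (f (z + (1, 0)) - f z) ^+ 2 +
     \sum_(z : K) (f (z + (0, 1)) - f z) ^+ 2 +
     (\sum_z (f (up1 z) - f z) ^+ 2 + \sum_z (f (up2 z) - f z) ^+ 2)).
Proof.
move=> f0; have N0 : 0 < (M.+2 ^ 2)%:R :> R by rewrite ltr0n expn_gt0.
have G0 : power f 0 = 0.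
  have d0 z : dot 0 z = 0 by rewrite /dot /= !mul0r addr0.
  rewrite /power /fcos /fsin.
  under eq_bigr => z _ do rewrite d0 cosZ0 mulr1.
  under [X in _ + X ^+ 2]eq_bigr => z _ do rewrite d0 sinZ0 mulr0.
  by rewrite f0 big1 // expr0n addr0.
have E1 := energy_linear f (can_inj up2K) (can_inj up1K) dot_up1.
have E2 := energy_linear f (can_inj up1K) (can_inj up2K) dot_up2.
have quad e : 15 * (\sum_(k | box (flip e k)) power f k) <=
    133 * (\sum_(k | far k) power f k) +
    396 * (\sum_k power_dist f k (up1 k) + \sum_k power_dist f k (up2 k)).
  have := @quadrant_bound (fun k => power f (flip e k))
    (fun k => power_dist f (flip e k) (flip e (up1 k)))
    (fun k => power_dist f (flip e k) (flip e (up2 k)))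
    (fun k => power_ge0 _ _) (fun k => power_dist_ge0 _ _ _)
    (fun k => power_dist_ge0 _ _ _) (fun k => power_le_dist _ _ _)
    (fun k => power_le_dist _ _ _).
  rewrite [X in 396 * X]big_split /= (sum_flip_dist _ (can_inj up1K) (flip_up1 e)).
  rewrite (sum_flip_dist _ (can_inj up2K) (flip_up2 e)).
  rewrite [X in 15 * X](reindex_inj (inv_inj (flipK e))).
  rewrite [X in 133 * X](reindex_inj (inv_inj (flipK e))) /=.
  under [X in 15 * X]eq_bigr => k _ do rewrite flipK.
  under [X in 133 * X]eq_bigr => k _ do rewrite flipK.
  by under [X in 133 * X]eq_bigl => k do rewrite far_flip.
have cover : \sum_k power f k <= \sum_(k | far k) power f k +
    \sum_e \sum_(k | box (flip e k)) power f k.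
  under [X in _ <= _ + X]eq_bigr => e _ do rewrite big_mkcond.
  rewrite (big_mkcond far) exchange_big -big_split; apply: ler_sum => k _ /=.
  have sum0 (P : pred (bool * bool)) : 0 <= \sum_(e | P e)
      (if box (flip e k) then power f k else 0).
    by apply: sumr_ge0 => e _; case: ifP => // _; apply: power_ge0.
  case: ifPn => [_|nfar]; first by rewrite lerDl.
  have [->|k0] := eqVneq k 0; first by rewrite G0 add0r sumr_ge0 // => ? _; case: ifP.
  have [e boxe] := flip_box k0 nfar.
  by rewrite add0r (bigD1 e) //= boxe lerDl.
rewrite -(ler_pM2l N0) -parseval.
have far_le := far_bound f.
(* Summing over four quadrants: 547 = 15 + 4 * 133 and 1584 = 4 * 396. The final 106 rounds up 1584
   / 15. *)
have {cover} : 15 * (\sum_k power f k) <= 547 * (\sum_(k | far k) power f k) +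
   1584 * (\sum_k power_dist f k (up1 k) + \sum_k power_dist f k (up2 k)).
  have /le_trans := ler_wpM2l (ler0n R 15) cover; apply.
  rewrite mulrDr [X in _ + X]mulr_sumr.
  have quads : \sum_e 15 * (\sum_(k | box (flip e k)) power f k) <=
      \sum_(e : bool * bool) (133 * (\sum_(k | far k) power f k) +
        396 * (\sum_k power_dist f k (up1 k) + \sum_k power_dist f k (up2 k))).
    by apply: ler_sum => e _; apply: quad.
  rewrite sumr_const card_prod card_bool in quads.
  by lra.
rewrite E1 E2; move: far_le; rewrite !mulrDr.
have T0 : 0 <= (M.+2 ^ 2)%:R * (\sum_(z : K) (f (z + (1, 0)) - f z) ^+ 2).
  by rewrite mulr_ge0 ?ler0n ?sumr_ge0 // => ? _; apply: sqr_ge0.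
have T1 : 0 <= (M.+2 ^ 2)%:R * (\sum_(z : K) (f (z + (0, 1)) - f z) ^+ 2).
  by rewrite mulr_ge0 ?ler0n ?sumr_ge0 // => ? _; apply: sqr_ge0.
have T2 : 0 <= (M.+2 ^ 2)%:R * (\sum_z (f (up1 z) - f z) ^+ 2).
  by rewrite mulr_ge0 ?ler0n ?sumr_ge0 // => ? _; apply: sqr_ge0.
have T3 : 0 <= (M.+2 ^ 2)%:R * (\sum_z (f (up2 z) - f z) ^+ 2).
  by rewrite mulr_ge0 ?ler0n ?sumr_ge0 // => ? _; apply: sqr_ge0.
rewrite !(mulrCA _ 106).
move: (_ * (\sum_(z : K) _)) (_ * (\sum_(z : K) _)) (_ * \sum_z _)
  (_ * \sum_z _) T0 T1 T2 T3 => x y z t *.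
by lra.
Qed.

End Torus.

(** * From quadratic forms to the spectrum *)

Lemma char_poly_conj (F : comNzRingType) n (P Q A : 'M[F]_n) :
  P *m Q = 1%:M -> char_poly (P *m A *m Q) = char_poly A.
Proof.
move=> PQ; rewrite /char_poly.
have -> : char_poly_mx (P *m A *m Q) =
    map_mx polyC P *m char_poly_mx A *m map_mx polyC Q.
  rewrite /char_poly_mx mulmxBr mulmxBl -!map_mxM.
  by rewrite mul_mx_scalar -scalemxAl -map_mxM PQ map_scalar_mx scalemx1.
rewrite !det_mulmx mulrAC -det_mulmx -map_mxM PQ map_scalar_mx det1 mul1r //.
Qed.

Lemma char_poly_ublock (F : comNzRingType) m n (A : 'M[F]_m) B (D : 'M[F]_n) :
  char_poly (block_mx A B 0 D) = char_poly A * char_poly D.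
Proof.
rewrite /char_poly /char_poly_mx map_block_mx map_mx0 scalar_mx_block.
by rewrite opp_block_mx add_block_mx oppr0 addr0 det_ublock.
Qed.

(* Conjugating a matrix of row sums 1 to a block matrix with diagonal blocks 1
   and [D]: if 1 is a multiple root it is also an eigenvalue of [D], and a left
   eigenvector of [D] lifts to one of total weight 0. *)
Lemma multiple_eigenvalue1 (F : fieldType) n (A : 'M[F]_n) :
  A *m const_mx 1 = const_mx 1 :> 'cV_n ->
  (('X - 1%:P) ^+ 2 %| char_poly A)%R ->
  exists2 w : 'rV_n, w != 0 & w *m A = w /\ \sum_j w 0 j = 0.
Proof.
case: n A => [|n] A.
  move=> _; rewrite /char_poly det_mx00 => /dvdp_leq.
  by rewrite oner_eq0 size_exp_XsubC size_poly1 => /(_ isT).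
rewrite -[n.+1]/(1 + n)%N in A *.
rewrite -[A]submxK; set a := ulsubmx A; set b := ursubmx A.
set c := dlsubmx A; set D := drsubmx A.
pose e : 'cV[F]_n := const_mx 1; pose i1 : 'cV[F]_1 := const_mx 1.
have -> : const_mx 1 = col_mx i1 e :> 'cV_(1 + n) by rewrite col_mx_const.
rewrite mul_block_col => /eq_col_mx [ab cD] dvdA.
have i1E : i1 = 1%:M by apply/matrixP => i j; rewrite !mxE !ord1.
rewrite i1E !mulmx1 in ab cD.
(* The first column of [Q] is the all-ones vector, which [A] fixes. *)
pose P : 'M[F]_(1 + n) := block_mx 1%:M 0 (- e) 1%:M.
pose Q : 'M[F]_(1 + n) := block_mx 1%:M 0 e 1%:M.
have PQ : P *m Q = 1%:M.
  rewrite mulmx_block !mulmx1 !mul1mx !mulmx0 mul0mx !addr0 add0r addNr.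
  by rewrite -scalar_mx_block.
have PAQ : P *m block_mx a b c D *m Q = block_mx 1%:M b 0 (D - e *m b).
  rewrite -mulmxA !mulmx_block !mulmx1 !mul1mx !mulmx0 !mul0mx !addr0 !add0r.
  by rewrite ab cD mulmx1 addNr mulNmx addrC.
have charA : char_poly (block_mx a b c D) = ('X - 1%:P) * char_poly (D - e *m b).
  rewrite -(char_poly_conj _ PQ) PAQ char_poly_ublock; congr (_ * _).
  by rewrite /char_poly det_mx11 !mxE eqxx.
have : root (char_poly (D - e *m b)) 1.
  by move: dvdA; rewrite charA expr2 dvdp_mul2l ?polyXsubC_eq0 // root_factor_theorem.
rewrite -eigenvalue_root_char => /eigenvalueP [x]; rewrite scale1r => xD x0.
(* This row is [(- x e, x)], whose entries sum to 0. *)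
exists (row_mx 0 x *m P).
  apply: contra_neq x0 => /(congr1 (mulmx^~ Q)).
  by rewrite -mulmxA PQ mulmx1 mul0mx -row_mx0 => /eq_row_mx [].
split.
  rewrite -[LHS]mulmx1 -(mulmx1C PQ) !mulmxA -(mulmxA (row_mx 0 x)).
  rewrite -(mulmxA (row_mx 0 x)) PAQ; congr (_ *m _).
  by rewrite mul_row_block !mul0mx mulmx0 !add0r xD.
rewrite mul_row_block !mul0mx mulmx1 !add0r mulmxN big_split_ord big_ord1 /=.
rewrite row_mxEl !mxE; under [X in _ + X]eq_bigr => j _ do rewrite row_mxEr.
by under [X in - X]eq_bigr => j _ do rewrite mxE mulr1; rewrite addNr.
Qed.

Lemma count_flatten_nseq (T : eqType) (s : seq T) (m : T -> nat) (P : pred T) :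
  count P (flatten [seq nseq (m a) a | a <- s]) =
  (\sum_(a <- s | P a) m a)%N.
Proof.
elim: s => [|a s IH] /=; first by rewrite big_nil.
by rewrite count_cat IH count_nseq big_cons; case: (P a); rewrite ?mul1n.
Qed.

(** [0 <= x] handles lists with fewer than two entries, where [nth] returns 0. *)
Lemma second_le (R : realDomainType) (s : seq R) (x : R) : 0 <= x ->
  (count (fun a => (x < a)%R) s <= 1)%N ->
  nth 0 (sort (fun a b => b <= a) s) 1 <= x.
Proof.
move=> x0; rewrite -(count_sort (fun a b : R => b <= a)).
have tot : total (fun a b : R => b <= a) by move=> a b; apply: le_total.
have := sort_sorted tot s; case: (sort _ s) => [|a [|b l]] //= /andP[ba _].
by rewrite leNgt; case: (ltP x b) => // xb; rewrite (lt_le_trans xb ba).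
Qed.

Section Spectrum.

Variables (R : realType) (G : sgraph).
Local Notation V := 'I_(nverts G).
Implicit Type f : V -> R.

Definition edge_sum (h : R -> R -> R) f : R :=
  \sum_u \sum_(v | adj u v) h (f u) (f v).

Hypothesis deg_gt0 : forall u : V, (0 < deg u)%N.

Lemma sum_adj_const (u : V) (x : R) : \sum_(v | adj u v) x = (deg u)%:R * x.
Proof. by rewrite sumr_const /deg cardsE mulr_natl. Qed.

(** The sign [e] is -1 for the Laplacian and 1 for the signless one; the factor 2 appears because
    [edge_sum] counts each edge in both directions. *)
Lemma edge_sumE (e : R) f : e ^+ 2 = 1 ->
  edge_sum (fun a b => (a + e * b) ^+ 2) f =
  (\sum_u (deg u)%:R * f u ^+ 2 + e * \sum_u f u * \sum_(v | adj u v) f v) *+ 2.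
Proof.
move=> e1; have E1 : \sum_u (deg u)%:R * f u ^+ 2 =
    \sum_u \sum_(v | adj u v) f u ^+ 2.
  by apply: eq_bigr => u _; rewrite sum_adj_const.
have E2 : \sum_u (deg u)%:R * f u ^+ 2 =
    \sum_u \sum_(v | adj u v) f v ^+ 2.
  rewrite E1 (exchange_big_dep xpredT) //=; apply: eq_bigr => u _.
  by apply: eq_bigl => v; rewrite adj_sym.
rewrite mulr2n [in X in _ + (X + _)]E2 [in X in X + _]E1 mulr_sumr.
rewrite -!big_split; apply: eq_bigr => u _ /=.
rewrite mulr_sumr mulr_sumr -!big_split; apply: eq_bigr => v _ /=.
rewrite sqrrD exprMn e1 mul1r mulr2n; lra.
Qed.

(** By reversibility, a left eigenvector divided by the degrees is a right eigenvector. *)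
Lemma srw_left_eigen (a : R) (w : 'rV_(nverts G)) :
  w *m srw_mx R G = a *: w ->
  let f u := w 0 u / (deg u)%:R in
  forall u, \sum_(v | adj u v) f v = a * ((deg u)%:R * f u).
Proof.
move=> wA f u; have d0 : (deg u)%:R != 0 :> R by rewrite pnatr_eq0 -lt0n.
move/matrixP/(_ 0 u): wA; rewrite !mxE /f (mulrC (deg u)%:R) divfK // => <-.
rewrite big_mkcond; apply: eq_bigr => v _; rewrite mxE adj_sym.
by case: ifP; rewrite ?mulr0.
Qed.

Lemma edge_sum_eigen (a e : R) f : e ^+ 2 = 1 ->
  (forall u, \sum_(v | adj u v) f v = a * ((deg u)%:R * f u)) ->
  edge_sum (fun a b => (a + e * b) ^+ 2) f =
  (1 + e * a) * (\sum_u (deg u)%:R * f u ^+ 2) *+ 2.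
Proof.
move=> e1 fa; rewrite edge_sumE //; congr (_ *+ 2).
rewrite mulrDl mul1r; congr (_ + _); rewrite -mulrA; congr (_ * _).
by rewrite mulr_sumr; apply: eq_bigr => u _; rewrite fa; lra.
Qed.

Variable delta : R.
Hypothesis delta_gt0 : 0 < delta.
Hypothesis delta_le1 : delta <= 1.
Hypothesis gap : forall f, \sum_u (deg u)%:R * f u = 0 ->
  delta * (\sum_u (deg u)%:R * f u ^+ 2) *+ 2 <=
  edge_sum (fun a b => (a + -1 * b) ^+ 2) f.
Hypothesis signless_gap : forall f,
  delta * (\sum_u (deg u)%:R * f u ^+ 2) *+ 2 <=
  edge_sum (fun a b => (a + 1 * b) ^+ 2) f.

Lemma weighted_sq_gt0 (w : 'rV[R]_(nverts G)) : w != 0 ->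
  0 < \sum_u (deg u)%:R * (w 0 u / (deg u)%:R) ^+ 2.
Proof.
move=> w0; have ge0 (u : V) : 0 <= (deg u)%:R * (w 0 u / (deg u)%:R) ^+ 2.
  by rewrite mulr_ge0 ?ler0n ?sqr_ge0.
rewrite lt_neqAle sumr_ge0 // andbT eq_sym psumr_neq0 //.
have /rV0Pn[u wu] := w0; apply/hasP; exists u; first exact: mem_index_enum.
rewrite /= mulr_gt0 ?ltr0n // lt_neqAle sqr_ge0 andbT eq_sym.
by rewrite expf_neq0 // mulf_neq0 // invr_eq0 pnatr_eq0 -lt0n.
Qed.

(** Rows sum to 1, so [a != 1] forces total weight 0. The two gaps then read [delta <= 1 - a] and
    [delta <= 1 + a]. The case of weight 0 with [a = 1] serves to exclude a double root. *)
Lemma eigen_le a (w : 'rV_(nverts G)) : w *m srw_mx R G = a *: w -> w != 0 ->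
  \sum_u w 0 u = 0 \/ a != 1 -> `|a| <= 1 - delta.
Proof.
move=> wA w0 sum0; have fa := srw_left_eigen wA; have pos := weighted_sq_gt0 w0.
set f := fun u : V => w 0 u / (deg u)%:R in fa pos.
have df (u : V) : (deg u)%:R * f u = w 0 u.
  by rewrite /f mulrC divfK // pnatr_eq0 -lt0n.
have bal : \sum_u (deg u)%:R * f u = 0.
  under eq_bigr do rewrite df; case: sum0 => // a1.
  have : \sum_u \sum_(v | adj u v) f v = a * \sum_u w 0 u.
    by rewrite mulr_sumr; apply: eq_bigr => u _; rewrite fa df.
  rewrite (exchange_big_dep xpredT) //=.
  have -> : \sum_v \sum_(u | adj u v) f v = \sum_u w 0 u.
    apply: eq_bigr => v _; under eq_bigl do rewrite adj_sym.
    by rewrite sum_adj_const df.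
  move/eqP; rewrite -subr_eq0 -{1}[\sum_u _]mul1r -mulrBl mulf_eq0 subr_eq0.
  by rewrite eq_sym (negPf a1) => /eqP.
have := signless_gap f; have := gap bal.
rewrite !(edge_sum_eigen _ fa) ?expr1n ?sqrrN ?expr1n // !lerMn2r /=.
rewrite !(ler_pM2r pos) => h1 h2; rewrite ler_norml; apply/andP; split; lra.
Qed.

Lemma char_poly_srw_neq0 : char_poly (srw_mx R G) != 0.
Proof. exact: monic_neq0 (char_poly_monic _). Qed.

Lemma mup1_srw : (mup 1 (char_poly (srw_mx R G)) <= 1)%N.
Proof.
rewrite leqNgt mup_geq ?char_poly_srw_neq0 //; apply/negP.
case/multiple_eigenvalue1 => [|w w0 [wA sumw]].
  apply/matrixP => u j; rewrite !mxE.
  under eq_bigr => v _ do rewrite !mxE mulr1.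
  rewrite -big_mkcond sum_adj_const mulfV // pnatr_eq0 -lt0n //.
have := @eigen_le 1 w; rewrite scale1r normr1 => /(_ wA w0 (or_introl sumw)).
by have := delta_gt0; lra.
Qed.

(** Only the simple root 1 can exceed [1 - delta] in absolute value. *)
Lemma lambda2_le : lambda2 (srw_mx R G) <= 1 - delta.
Proof.
rewrite /lambda2 second_le //; first by rewrite subr_ge0.
rewrite count_map count_flatten_nseq.
apply: leq_trans mup1_srw; set p := char_poly _.
rewrite big_seq_cond (eq_bigl (fun a => (a \in rootsR p) && (a == 1))) => [|a].
  rewrite -big_seq_cond; have [r1|r1] := boolP (1 \in rootsR p); last first.
    rewrite big_seq_cond big1 // => a /andP[ra /eqP a1].
    by rewrite a1 (negPf r1) in ra.
  by rewrite -big_filter filter_pred1_uniq ?uniq_roots // big_seq1.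
case: (boolP (a \in rootsR p)) => //= ra; apply/idP/eqP => [|->]; last first.
  by rewrite normr1 ltrBlDr ltrDl.
apply: contraTeq => a1; rewrite -leNgt.
have : root p a.
  have := roots_on_rootsR char_poly_srw_neq0 a; rewrite ra => /andP[_ ->] //.
rewrite -eigenvalue_root_char => /eigenvalueP[w wA w0].
exact: eigen_le wA w0 (or_intror a1).
Qed.

End Spectrum.

(** * A tree over the torus *)

(** Keeps the single term [v = s u] of each inner sum. The second alternative admits fixed points of
    [s], which carry no edge. *)
Lemma edge_sum_ge (R : realType) (G : sgraph) (h : R -> R -> R)
    (f : 'I_(nverts G) -> R) (P : pred 'I_(nverts G)) s :
  (forall a b, 0 <= h a b) ->
  (forall u, P u -> adj u (s u) \/ h (f u) (f (s u)) = 0) ->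
  \sum_(u | P u) h (f u) (f (s u)) <= edge_sum h f.
Proof.
move=> h0 Ps; rewrite /edge_sum big_mkcond; apply: ler_sum => u _.
have ge0 (Q : pred 'I_(nverts G)) : 0 <= \sum_(v | Q v) h (f u) (f v).
  by apply: sumr_ge0.
by case: ifP => // /Ps[us|->//]; rewrite (bigD1 (s u)) //= lerDl.
Qed.

Section TreeOverTorus.

Variable M : nat.
Local Notation m := M.+2.
Local Notation K := ('I_m * 'I_m)%type.
Local Notation n := (m * m)%N.
Local Notation V := 'I_n.*2.

Lemma size_enumK : size (enum {: K}) = n.
Proof. by rewrite -cardT card_prod card_ord. Qed.

Definition torus_point (i : nat) : K := nth (0, 0) (enum {: K}) i.

Lemma leaf_subproof (k : K) : (n + index k (enum {: K}) < n.*2)%N.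
Proof. by rewrite -addnn ltn_add2l -[ltnRHS]size_enumK index_mem mem_enum. Qed.

Definition leaf (k : K) : V := Ordinal (leaf_subproof k).

Lemma leafK k : torus_point (leaf k - n) = k.
Proof. by rewrite /= addKn /torus_point nth_index ?mem_enum. Qed.

Lemma torus_pointK (u : V) : (n <= u)%N -> leaf (torus_point (u - n)) = u.
Proof.
move=> nu; apply: val_inj; rewrite /= index_uniq ?enum_uniq ?subnKC //.
by rewrite size_enumK; have := ltn_ord u; lia.
Qed.

Lemma leaf_ge k : (n <= leaf k)%N.
Proof. exact: leq_addr. Qed.

Lemma sum_leaf (R : nmodType) (F : V -> R) :
  \sum_(u : V | (n <= u)%N) F u = \sum_k F (leaf k).
Proof.
rewrite (reindex_onto leaf (fun u : V => torus_point (u - n))) => [|u]; last first.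
  exact: torus_pointK.
by apply: eq_bigl => k; rewrite leaf_ge leafK eqxx.
Qed.

(** The shift by [(1 + 1, 0)] closes triangles with [(1, 0)]; inverse moves come from the
    symmetrization in [tot_adj]. *)
Definition shifts (k : K) : seq K :=
  [:: k + (1, 0); k + (1 + 1, 0); k + (0, 1); up1 k; up2 k].

(* The vertices form a binary heap with an extra vertex 0 on top, whose leaves
   [n, .., 2 n - 1] are identified with the torus; the torus edges are
   supplemented with those of a 4-ary heap on the leaves. *)
Definition base_edge (u v : V) : bool :=
  ((u == v./2 :> nat) ||
   [&& (n <= u)%N, (n <= v)%N &
     ((u - n == (v - n) %/ 4)%N || (torus_point (v - n) \in shifts (torus_point (u - n))))]).

Definition tot_adj (u v : V) : bool :=
  (u != v) && (base_edge u v || base_edge v u).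

Lemma tot_adj_sym : symmetric tot_adj.
Proof. by move=> u v; rewrite /tot_adj eq_sym orbC. Qed.

Lemma tot_adj_irr : irreflexive tot_adj.
Proof. by move=> u; rewrite /tot_adj eqxx. Qed.

Definition tree_over_torus : sgraph := SGraph tot_adj_sym tot_adj_irr.
Local Notation G := tree_over_torus.

Lemma parent_subproof (u : V) : (u./2 < n.*2)%N.
Proof. by apply: leq_ltn_trans (ltn_ord u); rewrite leq_half_double; lia. Qed.

Definition parent (u : V) : V := Ordinal (parent_subproof u).
Definition top : V := Ordinal (isT : (0 < n.*2)%N).

Lemma adj_parent (u : V) : (0 < u)%N -> tot_adj u (parent u).
Proof.
move=> u0; rewrite /tot_adj /base_edge /= eqxx orbT andbT.
by apply/eqP => /(congr1 val) /=; lia.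
Qed.

Lemma adj_top (v : V) : tot_adj top v = (v == 1 :> nat).
Proof.
rewrite /tot_adj /base_edge -val_eqE /=.
by rewrite andbF !orbF; case: (nat_of_ord v) => [|[|i]].
Qed.

Lemma adj_internal (p v : V) : (p < n)%N -> tot_adj p v ->
  v = parent p \/ parent v = p.
Proof.
move=> pn; rewrite /tot_adj /base_edge [(n <= p)%N]leqNgt pn /= andbF !orbF.
case/andP=> _ /orP[/eqP pv|/eqP vp]; first by right; apply: val_inj.
by left; apply: val_inj.
Qed.

Lemma adj_core (k l : K) : k != l -> l \in shifts k -> tot_adj (leaf k) (leaf l).
Proof.
move=> kl lk; rewrite /tot_adj; apply/andP; split.
  by apply: contra kl => /eqP kl; rewrite -(leafK k) kl leafK.
by rewrite /base_edge !leafK lk !leaf_ge !orbT.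
Qed.

Definition shifts_inv (k : K) : seq K :=
  [:: k - (1, 0); k - (1 + 1, 0); k - (0, 1); down1 k; down2 k].

Lemma shifts_invP k l : (l \in shifts k) = (k \in shifts_inv l).
Proof.
rewrite !inE; congr [|| _, _, _, _ | _].
- by rewrite [RHS]eq_sym subr_eq.
- by rewrite [RHS]eq_sym subr_eq.
- by rewrite [RHS]eq_sym subr_eq.
- by rewrite eq_sym (can2_eq (@up1K _) (@down1K _)).
- by rewrite eq_sym (can2_eq (@up2K _) (@down2K _)).
Qed.

Lemma deg_le (u : 'I_(nverts G)) : (deg u <= 18)%N.
Proof.
pose k0 := torus_point (u - n).
(* Candidates: 3 from the binary heap, 5 from the 4-ary heap, and 10 from the shifts and their
   inverses. *)
pose s : seq nat := [:: u./2; u.*2; u.*2.+1; n + (u - n) %/ 4; n + 4 * (u - n);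
  n + 4 * (u - n) + 1; n + 4 * (u - n) + 2; n + 4 * (u - n) + 3]%N ++
  [seq nat_of_ord (leaf k) | k <- shifts k0 ++ shifts_inv k0].
rewrite /deg cardE -(size_map val) -[18%N]/(size s).
apply: uniq_leq_size; first by rewrite map_inj_uniq ?enum_uniq //; apply: val_inj.
move=> _ /mapP[v + ->]; rewrite mem_enum inE /= /tot_adj => /andP[_].
rewrite /base_edge => /orP[/orP[/eqP uv|/and3P[nu nv]]|/orP[/eqP vu|/and3P[nv nu]]].
- have : (v == u.*2 :> nat) || (v == u.*2.+1 :> nat).
    rewrite uv -[in X in X == _](odd_double_half v).
    rewrite -[in X in _ || (X == _)](odd_double_half v).
    by case: (odd v); rewrite ?eqxx ?orbT.
  by rewrite mem_cat !inE => /orP[] ->; rewrite ?orbT.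
- case/orP => [/eqP uv|sv].
    rewrite mem_cat; apply/orP; left; rewrite !inE.
    by move: nu nv uv; move: (nat_of_ord u) (nat_of_ord v) => a b; lia.
  rewrite mem_cat; apply/orP; right; apply/mapP; exists (torus_point (v - n)).
    by rewrite mem_cat sv.
  by rewrite torus_pointK.
- by rewrite mem_cat !inE vu eqxx.
- case/orP => [/eqP vu|sv].
    rewrite mem_cat; apply/orP; left; rewrite !inE.
    by move: nu nv vu; move: (nat_of_ord u) (nat_of_ord v) => a b; lia.
  rewrite mem_cat; apply/orP; right; apply/mapP; exists (torus_point (v - n)).
    by rewrite mem_cat -shifts_invP sv orbT.
  by rewrite torus_pointK.
Qed.

Lemma deg_internal (p : 'I_(nverts G)) : (0 < p)%N -> (p < n)%N -> deg p = 3.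
Proof.
move=> p0 pn; have c1 : (p.*2.+1 < n.*2)%N by rewrite ltn_Sdouble.
pose c b : V := if b then Ordinal c1 else Ordinal (ltnW c1).
have cE b : c b = (b + p.*2)%N :> nat by case: b.
have -> : deg p = #|[set parent p; c false; c true]|.
  apply: eq_card => v; rewrite !inE; apply/idP/idP.
    case/(adj_internal pn) => [->|vp]; first by rewrite eqxx.
    rewrite -orbA; apply/orP; right; have := odd_double_half v.
    case: (odd v) => Ev; apply/orP; [right|left];
      by apply/eqP/val_inj; rewrite /= -{1}Ev -vp.
  have up b : tot_adj p (c b).
    rewrite tot_adj_sym; have -> : p = parent (c b).
      by apply: val_inj; rewrite /= cE half_bit_double.
    by apply: adj_parent; rewrite cE; lia.
  by rewrite -orbA => /or3P[] /eqP -> //; apply: adj_parent.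
rewrite -finset.setUA !cardsU1 cards1 !inE -!val_eqE /=.
have -> : (p./2 == p.*2)%N = false by apply/eqP; lia.
have -> : (p./2 == p.*2.+1)%N = false by apply/eqP; lia.
by have -> : (p.*2 == p.*2.+1)%N = false by apply/eqP; lia.
Qed.

Lemma deg_gt0 (u : 'I_(nverts G)) : (0 < deg u)%N.
Proof.
apply/card_gt0P; have [u0|] := posnP u; last first.
  by move=> u0; exists (parent u); rewrite inE; apply: adj_parent.
have n1 : (1 < n.*2)%N by [].
exists (Ordinal n1); rewrite inE; have -> : u = top by apply: val_inj.
by rewrite /= adj_top.
Qed.

Lemma max_degree_le : (max_degree G <= 18)%N.
Proof. by apply/bigmax_leqP => u _; apply: deg_le. Qed.

Lemma tot_connected : connected_graph G.
Proof.
split=> //; have sym : connect_sym (@adj G).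
  by apply: sym_connect_sym; apply: tot_adj_sym.
suff to_top (u : V) : connect (@adj G) u top.
  by move=> u v; apply: connect_trans (to_top u) _; rewrite sym.
have [k] := ubnP (nat_of_ord u); elim: k u => // k IH u uk.
have [u0|u0] := posnP u; first by have -> : u = top by apply: val_inj.
apply: connect_trans (connect1 (adj_parent u0)) (IH _ _) => /=.
by move: u0 uk; move: (nat_of_ord u) => a; lia.
Qed.

Definition rotor_order (u : V) : seq V :=
  [seq v <- enum V | tot_adj u v && (v != parent u)] ++
  [seq v <- enum V | tot_adj u v && (v == parent u)].

Lemma mem_rotor_order u v : (v \in rotor_order u) = tot_adj u v.
Proof.
rewrite mem_cat mem_filter [X in _ || X]mem_filter !fintype.mem_enum !andbT.
rewrite -andb_orr.
by rewrite orbC orbN andbT.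
Qed.

Lemma rotor_order_uniq u : uniq (rotor_order u).
Proof.
rewrite cat_uniq; apply/and3P.
split; [exact/filter_uniq/enum_uniq | | exact/filter_uniq/enum_uniq].
apply/hasPn => v; rewrite mem_filter => /andP[/andP[_ /eqP ->] _].
by rewrite /= mem_filter eqxx andbF.
Qed.

Lemma size_rotor_order (u : 'I_(nverts G)) : size (rotor_order u) = deg u.
Proof.
exact: (@size_o G rotor_order rotor_order_uniq mem_rotor_order u).
Qed.

Lemma index_parent (u : V) : (0 < u)%N ->
  index (parent u) (rotor_order u) = (size (rotor_order u)).-1.
Proof.
move=> /adj_parent up; rewrite /rotor_order index_cat size_cat mem_filter eqxx andbF.
have -> : [seq v <- enum V | tot_adj u v && (v == parent u)] = [:: parent u].
  rewrite -(filter_pred1_uniq (enum_uniq V) (mem_enum _ (parent u))).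
  apply: eq_filter => v /=.
  by case: eqP => [->|]; rewrite ?up ?andbF.
by rewrite /= eqxx addn0 addn1.
Qed.

End TreeOverTorus.

(** * Spectral gap of the tree over the torus *)

Section Gap.

Variables (R : realType) (M q : nat).
Hypothesis q4 : (4 * q)%N = M.+2.
Local Notation m := M.+2.
Local Notation K := ('I_m * 'I_m)%type.
Local Notation n := (m * m)%N.
Local Notation V := 'I_n.*2.
Local Notation G := (tree_over_torus M).
Implicit Type f : 'I_(nverts G) -> R.

Local Notation energy e f := (edge_sum (fun a b : R => (a + e * b) ^+ 2) f).

Lemma sum_half (F : nat -> R) k :
  \sum_(c < k.*2) F c./2 = (\sum_(p < k) F p) *+ 2.
Proof.
elim: k => [|k IH]; first by rewrite !big_ord0 mul0rn.
by rewrite doubleS !big_ord_recr /= IH doubleK uphalf_double mulrnDl [X in _ = _ + X]mulr2n addrA.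
Qed.

(** Each [u < n] is the parent of [2 u] and [2 u + 1]; for 0 these are 0 itself and 1. *)
Lemma sum_parent (f : V -> R) :
  \sum_u f (parent u) = (\sum_(u : V | (u < n)%N) f u) *+ 2.
Proof.
pose F i := f (insubd (top M) i).
have FE (u : V) : F u = f u by rewrite /F valKd.
have nn : (n <= n.*2)%N by rewrite -addnn leq_addr.
under [X in X *+ 2]eq_bigr => u _ do rewrite -FE.
rewrite -(big_ord_widen _ F nn) -sum_half; apply: eq_bigr => u _.
by rewrite -[u./2]/(nat_of_ord (parent u)) FE.
Qed.

Lemma energy_ge0 e f : 0 <= energy e f.
Proof. by apply: sumr_ge0 => u _; apply: sumr_ge0 => v _; apply: sqr_ge0. Qed.

(* Every internal vertex has two children, so each of them has to carry at least
   half of its share, up to the energy. *)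
Lemma tree_bound (e : R) f : e ^+ 2 = 1 ->
  \sum_(u : V | (u < n)%N) f u ^+ 2 <=
  6 * energy e f + 3 * (\sum_(u : V | (n <= u)%N) f u ^+ 2).
Proof.
move=> e1; have := sum_parent (fun u => f u ^+ 2) => /= sum_p.
have : \sum_(u : V | u != top M) f (parent u) ^+ 2 <=
    3 * energy e f + 3 / 2 * (\sum_(u : V | u != top M) f u ^+ 2).
  have := @edge_sum_ge R G (fun a b => (a + e * b) ^+ 2) f
    (fun u => u != top M) (@parent M) (fun a b => sqr_ge0 _).
  move=> /(_ _)/(ler_wpM2l (ler0n R 3)) h.
  apply: le_trans (lerD (h _) (lexx _)) => [|u u0].
    rewrite !mulr_sumr -big_split; apply: ler_sum => u _ /=.
    move: (f u) (f (parent u)) => a b.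
    (* With b' = e b, one has 3 (a + b')^2 + 3/2 a^2 - b'^2 = (3 a + 2 b')^2 / 2. The factor 3/2 is
       below 2, the number of children. *)
    have -> : b ^+ 2 = (e * b) ^+ 2 by rewrite exprMn e1 mul1r.
    by have := sqr_ge0 (3 * a + 2 * (e * b)); lra.
  by left; apply: adj_parent; rewrite lt0n.
have {1}-> : \sum_(u : V | u != top M) f (parent u) ^+ 2 =
    (\sum_(u : V | (u < n)%N) f u ^+ 2) *+ 2 - f (top M) ^+ 2.
  rewrite -sum_p [in RHS](bigD1 (top M)) //=.
  have -> : parent (top M) = top M by apply: val_inj.
  by rewrite [RHS]addrC addKr.
have -> : \sum_(u : V | u != top M) f u ^+ 2 =
    \sum_(u : V | (u < n)%N) f u ^+ 2 + \sum_(u : V | (n <= u)%N) f u ^+ 2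
    - f (top M) ^+ 2.
  have -> : \sum_(u : V | (u < n)%N) f u ^+ 2 + \sum_(u : V | (n <= u)%N) f u ^+ 2
      = \sum_u f u ^+ 2.
    rewrite [RHS](bigID (fun u : V => (u < n)%N)) /=; congr (_ + _).
    by apply: eq_bigl => u; rewrite -leqNgt.
  by rewrite [in RHS](bigD1 (top M)) //= [RHS]addrC addKr.
have := sqr_ge0 (f (top M)); set t := f (top M) ^+ 2.
by move=> t0 h; lra.
Qed.

(** A fixed point of [s] is no edge: it contributes 0 if [e = -1] and has to be excluded
    otherwise. *)
Lemma shift_energy (e : R) f (s : K -> K) : (forall k, s k \in shifts k) ->
  e = -1 \/ (forall k, s k != k) ->
  \sum_k (f (leaf k) + e * f (leaf (s k))) ^+ 2 <= energy e f.
Proof.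
move=> s_in es; pose s' (u : V) := leaf (s (torus_point M (u - n))).
have := @edge_sum_ge R G (fun a b => (a + e * b) ^+ 2) f
    (fun u => (n <= u)%N) s' (fun a b => sqr_ge0 _).
have -> : \sum_(u < nverts G | (n <= u)%N) (f u + e * f (s' u)) ^+ 2 =
    \sum_k (f (leaf k) + e * f (leaf (s k))) ^+ 2.
  by rewrite [LHS]sum_leaf; apply: eq_bigr => k _; rewrite /s' leafK.
apply=> u nu; have [sk|sk] := eqVneq (s (torus_point M (u - n))) (torus_point M (u - n)).
  right; rewrite /s' sk torus_pointK //; case: es => [->|/(_ (torus_point M (u - n)))].
    by rewrite mulN1r subrr expr0n.
  by rewrite sk eqxx.
left; rewrite -{1}(torus_pointK nu) /s'; apply: adj_core (s_in _).
by rewrite eq_sym.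
Qed.

Lemma core_gap f : \sum_k f (leaf k) = 0 ->
  \sum_k f (leaf k) ^+ 2 <= 424 * energy (-1) f.
Proof.
move=> /(torus_gap q4) /le_trans; apply.
have sqE (s : K -> K) : (forall k, s k \in shifts k) ->
    \sum_k (f (leaf (s k)) - f (leaf k)) ^+ 2 <= energy (-1) f.
  move=> s_in; have := @shift_energy (-1) f s s_in (or_introl erefl).
  by under eq_bigr => k _ do rewrite mulN1r -sqrrN opprB.
have in_shifts (k : K) : [/\ k + (1, 0) \in shifts k, k + (0, 1) \in shifts k,
    up1 k \in shifts k & up2 k \in shifts k].
  by split; rewrite !inE eqxx ?orbT.
have h1 : \sum_(k : K) (f (leaf (k + (1, 0))) - f (leaf k)) ^+ 2 <= energy (-1) f.
  by apply: (sqE (fun k => k + (1, 0))) => k; case: (in_shifts k).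
have h2 : \sum_(k : K) (f (leaf (k + (0, 1))) - f (leaf k)) ^+ 2 <= energy (-1) f.
  by apply: (sqE (fun k => k + (0, 1))) => k; case: (in_shifts k).
have h3 : \sum_(k : K) (f (leaf (up1 k)) - f (leaf k)) ^+ 2 <= energy (-1) f.
  by apply: sqE => k; case: (in_shifts k).
have h4 : \sum_(k : K) (f (leaf (up2 k)) - f (leaf k)) ^+ 2 <= energy (-1) f.
  by apply: sqE => k; case: (in_shifts k).
by lra.
Qed.

(* Each [k] lies in the triangle formed with [k + (1, 0)] and [k + (2, 0)]. *)
Lemma core_signless f : 4 * \sum_k f (leaf k) ^+ 2 <= 9 * energy 1 f.
Proof.
have ne1 (k : K) : k + (1, 0) != k.
  by rewrite -subr_eq0 addrAC subrr add0r.
have ne2 (k : K) : k + (1 + 1, 0) != k.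
  rewrite -subr_eq0 addrAC subrr add0r xpair_eqE negb_and -val_eqE /=.
  by rewrite !modn_small //; lia.
have h1 : \sum_(k : K) (f (leaf k) + 1 * f (leaf (k + (1, 0)))) ^+ 2 <= energy 1 f.
  apply: (shift_energy _ (s := fun k => k + (1, 0))); last by right; apply: ne1.
  by move=> k; rewrite !inE eqxx.
have h2 : \sum_(k : K) (f (leaf k) + 1 * f (leaf (k + (1 + 1, 0)))) ^+ 2
    <= energy 1 f.
  apply: (shift_energy _ (s := fun k => k + (1 + 1, 0))); last by right; apply: ne2.
  by move=> k; rewrite !inE eqxx orbT.
(* The third side of the triangle at [k] is the first side of that at [k + (1, 0)]. *)
have h3 : \sum_(k : K) (f (leaf (k + (1, 0))) + 1 * f (leaf (k + (1 + 1, 0)))) ^+ 2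
    <= energy 1 f.
  apply: le_trans h1; rewrite [leRHS](reindex_inj (addIr (1, 0))) /=.
  rewrite le_eqVlt; apply/orP; left; apply/eqP/eq_bigr => k _.
  have -> // : k + (1 + 1, 0) = k + (1, 0) + (1, 0).
  by rewrite -addrA -[(1, 0) + (1, 0)]/(1 + 1, 0 + 0) addr0.
have : 4 * \sum_k f (leaf k) ^+ 2 <= 3 * (
    \sum_(k : K) (f (leaf k) + 1 * f (leaf (k + (1, 0)))) ^+ 2 +
    \sum_(k : K) (f (leaf k) + 1 * f (leaf (k + (1 + 1, 0)))) ^+ 2 +
    \sum_(k : K) (f (leaf (k + (1, 0))) + 1 * f (leaf (k + (1 + 1, 0)))) ^+ 2).
  rewrite -!big_split !mulr_sumr; apply: ler_sum => k _ /=; rewrite !mul1r.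
  move: (f _) (f _) (f _) => c b a.
  rewrite -subr_ge0; have -> : 3 * ((a + b) ^+ 2 + (a + c) ^+ 2 + (b + c) ^+ 2) -
      4 * a ^+ 2 = (b - c) ^+ 2 + (a + 2 * b + c) ^+ 2 + (a + b + 2 * c) ^+ 2 by lra.
  by rewrite !addr_ge0 ?sqr_ge0.
by lra.
Qed.

Lemma sum_split f : \sum_u f u =
  \sum_(u : V | (u < n)%N) f u + \sum_k f (leaf k).
Proof.
rewrite (bigID (fun u : V => (u < n)%N)) /= -sum_leaf; congr (_ + _).
by apply: eq_bigl => u; rewrite -leqNgt.
Qed.

Lemma deg_sum_le f : \sum_u (deg u)%:R * f u ^+ 2 <= 18 * \sum_u f u ^+ 2 :> R.
Proof.
rewrite mulr_sumr; apply: ler_sum => u _.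
by rewrite ler_wpM2r ?sqr_ge0 // ler_nat deg_le.
Qed.

(** Subtracting the mean over the leaves keeps the energy and, as [f] has weighted mean 0, does not
    decrease the weighted norm. With 424 = 4 * 106 from the torus, the constant is 18 * (6 + 4 *
    424) = 30636, twice which is below 300 * 300. *)
Lemma tot_gap f : \sum_u (deg u)%:R * f u = 0 ->
  (300^-1 * 300^-1) * (\sum_u (deg u)%:R * f u ^+ 2) *+ 2 <= energy (-1) f.
Proof.
move=> f0; pose mu := (\sum_k f (leaf k)) / n%:R.
pose g (u : 'I_(nverts G)) := f u - mu.
have -> : energy (-1) f = energy (-1) g.
  by apply: eq_bigr => u _; apply: eq_bigr => v _; rewrite /g; congr (_ ^+ 2); lra.
have g0 : \sum_k g (leaf k) = 0.
  rewrite /g sumrB sumr_const card_prod !card_ord -[mu *+ _]mulr_natr /mu divfK ?subrr //.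
have le_fg : \sum_u (deg u)%:R * f u ^+ 2 <= \sum_u (deg u)%:R * g u ^+ 2.
  have -> : \sum_u (deg u)%:R * g u ^+ 2 = \sum_u (deg u)%:R * f u ^+ 2
      - 2 * mu * \sum_u (deg u)%:R * f u + mu ^+ 2 * \sum_(u < nverts G) (deg u)%:R.
    rewrite !mulr_sumr -sumrB -big_split; apply: eq_bigr => u _ /=.
    by rewrite /g; lra.
  rewrite f0 mulr0 subr0 lerDl mulr_ge0 ?sqr_ge0 // sumr_ge0 // => u _; exact: ler0n.
have := deg_sum_le g; rewrite (sum_split (fun u => g u ^+ 2)).
have := @tree_bound (-1) g; rewrite sqrrN expr1n => /(_ erefl).
rewrite sum_leaf; have := core_gap g0.
move: (energy _ g) (energy_ge0 (-1) g) le_fg => E E0.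
by move=> *; lra.
Qed.

Lemma tot_signless_gap f :
  (300^-1 * 300^-1) * (\sum_u (deg u)%:R * f u ^+ 2) *+ 2 <= energy 1 f.
Proof.
have := deg_sum_le f; rewrite (sum_split (fun u => f u ^+ 2)).
have := tree_bound f (expr1n R 2); rewrite sum_leaf; have := core_signless f.
move: (energy _ f) (energy_ge0 1 f) => E E0.
by move=> *; lra.
Qed.

Lemma tot_lambda2 : lambda2 (srw_mx R G) <= 1 - (300^-1 * 300^-1).
Proof.
apply: lambda2_le; [exact: deg_gt0 | lra | lra | exact: tot_gap | ].
exact: tot_signless_gap.
Qed.

End Gap.

Local Open Scope nat_scope.

(** * Visiting the top of the tree *)

Section HiddenTop.

Variables (j M : nat).
(** There are then [4 ^ j] leaves: the 4-ary heap has depth [j], the binary tree depth [2 j]. *)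
Hypothesis Mj : M.+2 = 2 ^ j.
Local Notation n := (M.+2 * M.+2).
Local Notation V := 'I_n.*2.
Local Notation G := (tree_over_torus M).

Lemma n_exp4 : n = 4 ^ j.
Proof. by rewrite Mj -expnMn. Qed.

Lemma heap_parent_subproof (u : V) : n + (u - n) %/ 4 < n.*2.
Proof.
have n_gt0 : 0 < n by [].
move: (nat_of_ord u) (ltn_ord u) n_gt0; move: n => k a.
by have := leq_div (a - k) 4; lia.
Qed.

(** The identity off the leaves, as [ball_time] takes a map on all vertices. *)
Definition heap_parent (u : V) : V :=
  if n <= u then Ordinal (heap_parent_subproof u) else u.

Lemma heap_parent_adj (u : V) :
  heap_parent u = u \/ heap_parent u \in rotor_order u.
Proof.
have [|neq] := eqVneq (heap_parent u) u; first by left.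
right; rewrite mem_rotor_order /tot_adj eq_sym neq /base_edge /=.
move: neq; rewrite /heap_parent; case: (leqP n u) => nu; last by rewrite eqxx.
by rewrite /= leq_addr addKn eqxx !orbT.
Qed.

Lemma heap_parentE (u : V) : n <= u -> heap_parent u = n + (u - n) %/ 4 :> nat.
Proof. by rewrite /heap_parent => ->. Qed.

Lemma iter_heap_parent (u : V) i : n <= u ->
  iter i heap_parent u = n + (u - n) %/ 4 ^ i :> nat.
Proof.
move=> nu; elim: i => [|i IH]; first by rewrite divn1 subnKC.
by rewrite iterS heap_parentE IH ?leq_addr // addKn -divnMA -expnSr.
Qed.

Lemma core_root_subproof : n < n.*2.
Proof. by rewrite -addnn -[ltnLHS]addn0 ltn_add2l. Qed.

Definition core_root : V := Ordinal core_root_subproof.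

Lemma card_core : #|[pred u : V | n <= u]| = n.
Proof.
by rewrite -sum1_card sum_leaf sum1_card card_prod card_ord.
Qed.

(** The delay yields a leaf whose arc to its parent has been used more than [2 j] times. As all
    leaves are within [j] heap steps of the root, [ball_time] gives [n * (2 j - (j + 1))]. *)
Lemma top_late (X : nat -> V) t :
  (forall i, X i.+1 =
     nth (X i) (rotor_order (X i)) (exits X i (X i) %% size (rotor_order (X i)))) ->
  X 0 = core_root -> X t = top M -> n * (j - 1) <= t.
Proof.
move=> stepX X0 Xt.
have o_gt0 (u : V) : 0 < size (rotor_order u) by rewrite size_rotor_order deg_gt0.
have o_sym (u v : V) : (u \in rotor_order v) = (v \in rotor_order u).
  by rewrite !mem_rotor_order tot_adj_sym.
pose I (u : V) := (0 < u) && (u < n).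
pose h (u : V) := (trunc_log 2 u).+1.
have parentS (u : V) : 1 < u -> h u = (h (parent u)).+1.
  by move=> u1; rewrite /h trunc_log2S.
have Ip p : I p ->
    [/\ size (rotor_order p) = 3, index (parent p) (rotor_order p) = 2 & 0 < h p].
  case/andP=> p0 pn; rewrite index_parent // size_rotor_order.
  by rewrite (deg_internal p0 pn).
have Iparent p : I p -> parent p = top M \/ I (parent p) /\ (h (parent p)).+1 = h p.
  case/andP=> p0 pn; have [p1|p1] := ltnP 1 p; last first.
    by left; apply: val_inj => /=; move: p0 p1; case: (nat_of_ord p) => [|[|i]].
  right; rewrite (parentS p p1) /I [nat_of_ord (parent p)]/= half_gt0 p1; split=> //.
  by apply: leq_ltn_trans pn; rewrite leq_half_double; lia.
have Ichild p u : I p -> u \in rotor_order p -> u != parent p ->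
    h u = (h p).+1 /\ parent u = p.
  case/andP=> p0 pn; rewrite mem_rotor_order => /(adj_internal pn)[->|up _].
    by rewrite eqxx.
  split=> //; rewrite -up parentS //.
  by move: p0; rewrite -up /= half_gt0.
have top_nbr u : u \in rotor_order (top M) -> [/\ I u, h u = 1 & parent u = top M].
  rewrite mem_rotor_order adj_top => /eqP u1; rewrite /I /h u1; split=> //.
  by apply: val_inj; rewrite /= u1.
have [||s [c [p [le_st Ipp pc cp [nIc late]]]]] :=
    hidden_delay (@rotor_order_uniq M) o_gt0 o_sym stepX Ip Iparent Ichild top_nbr _ _ Xt.
- by rewrite X0 /I /= ltnn ?andbF.
- by rewrite X0.
apply: leq_trans le_st.
have [_ parent_c] := Ichild p c Ipp pc cp.
have nc : n <= c.
  move: nIc; rewrite /I negb_and -leqNgt -leqNgt leqn0 => /orP[/eqP c0|//].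
  by move: Ipp; rewrite -parent_c /I /= c0.
have hc : j.*2 < h c.
  rewrite ltnS; apply: trunc_log_max => //; apply: leq_trans nc.
  by rewrite n_exp4 -muln2 mulnC expnM.
rewrite -{1}card_core; have -> : j - 1 = j.*2 - j.+1 by rewrite -addnn; lia.
apply: (ball_time (@rotor_order_uniq M) o_gt0 o_sym stepX heap_parent_adj _ X0
  (leq_trans hc late)) => x /= nx.
apply: val_inj; rewrite /= iter_heap_parent // divn_small ?addn0 //.
by rewrite -n_exp4 ltn_subLR // addnn.
Qed.

Local Open Scope ring_scope.

(** Since [ln (2 n) <= 2 j + 1 <= 5 (j - 1)] for [j >= 2], the bound [n (j - 1)] is at least a tenth
    of [2 n ln (2 n)]. *)
Lemma cover_time_ge (R : realType) (dt : 'I_(nverts G) -> nat) :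
  (2 <= j)%N -> rotor_lengths dt ->
  ((10^-1 * (nverts G)%:R * ln (nverts G)%:R : R)%:E <=
   det_vertex_cover_time R dt)%E.
Proof.
move=> j2 dtl.
have uniq_o (u : 'I_(nverts G)) : uniq (rotor_order u).
  exact: rotor_order_uniq.
have mem_o (u v : 'I_(nverts G)) : (v \in rotor_order u) = adj u v.
  exact: mem_rotor_order.
pose s := @copies G (@rotor_order M) dt.
apply: (@le_trans _ _ (cover_time R s (fun=> 0%N) (core_root : 'I_(nverts G)))).
  apply: le_ereal_inf_tmp => _ [t cov <-]; rewrite lee_fin.
  have [i le_it Xi] := cov (top M).
  have := @top_late (det_walk s (fun=> 0%N) (core_root : 'I_(nverts G))) i.
  move=> /(_ (det_walk_copies uniq_o mem_o dtl _) erefl Xi) le_i.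
  have {le_i le_it}: (n * (j - 1) <= t)%N by apply: leq_trans le_it.
  rewrite -(ler_nat R) => le_t; apply: le_trans le_t.
  have ln2 : ln 2 <= 1 :> R.
    by have := @le_ln1Dx R 1; rewrite -[1 + 1]/(2 : R); apply; lra.
  have lnN : ln (nverts G)%:R <= (j.*2.+1)%:R :> R.
    have -> : nverts G = (2 ^ (j.*2).+1)%N.
      by rewrite /= n_exp4 expnS mul2n -[j.*2]mul2n expnM.
    by rewrite natrX lnXn ?ltr0n // -[ln 2 *+ _]mulr_natl ler_piMr.
  have j5 : (j.*2.+1)%:R <= 5 * (j - 1)%:R :> R.
    by rewrite -natrM ler_nat -addnn; lia.
  have nG : (nverts G)%:R = 2 * n%:R :> R by rewrite /= -mul2n natrM.
  rewrite {1}nG [(n * (j - 1))%:R]natrM; move: (ln _) lnN => l lnN.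
  have n0 : 0 <= n%:R :> R by exact: ler0n.
  apply: (@le_trans _ _ (10^-1 * (2 * n%:R) * (5 * (j - 1)%:R))).
    by rewrite ler_wpM2l ?(le_trans lnN) // !mulr_ge0.
  by rewrite le_eqVlt; apply/orP; left; apply/eqP; lra.
apply: ereal_sup_ubound; exists s, (fun=> 0%N), core_root; split=> //.
  exact: copies_rotor_sequences.
by move=> u; case: (dtl u).
Qed.

End HiddenTop.

Local Open Scope classical_set_scope.
Local Open Scope ring_scope.

Theorem theorem4p5 (R : realType) :
  exists (D : nat) (B c : R),
    [/\ (0 < D)%N, 0 < B & 0 < c] /\
    exists F : set sgraph,
      (forall N : nat, exists2 G : sgraph, F G & (N <= nverts G)%N) /\
      (forall G : sgraph, F G ->
        [/\ connected_graph G,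
            (max_degree G <= D)%N,
            lambda2 (srw_mx R G) < 1 /\ 1 / (1 - lambda2 (srw_mx R G)) <= B &
            forall dt : 'I_(nverts G) -> nat, rotor_lengths dt ->
              ((c * (nverts G)%:R * ln (nverts G)%:R)%:E
                 <= det_vertex_cover_time R dt)%E]).
Proof.
exists 18%N, (300 * 300), 10^-1; split; first by split=> //; lra.
(* The side [2 ^ i.+2] is four times [q = 2 ^ i], as the torus gap requires, and its exponent is at
   least 2. *)
have expE i : (2 ^ i.+2 - 2).+2 = (2 ^ i.+2)%N.
  by rewrite -addn2 subnK // !expnS; have := expn_gt0 2 i; lia.
exists [set tree_over_torus (2 ^ i.+2 - 2) | i in [set: nat]]; split=> [N|_ [i _ <-]].
  exists (tree_over_torus (2 ^ N.+2 - 2)); first by exists N.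
  rewrite /= expE -addnn; apply: leq_trans (leq_addr _ _).
  apply: leq_trans (leq_pmulr _ _); last by rewrite expn_gt0.
  apply: ltnW; apply: (@leq_trans (2 ^ N)%N); first exact: ltn_expl.
  by rewrite leq_exp2l //; lia.
have lam := @tot_lambda2 R (2 ^ i.+2 - 2) (2 ^ i).
rewrite expE -[(4 * _)%N]/(2 ^ 2 * 2 ^ i)%N -expnD in lam.
have {}lam := lam erefl.
split.
- exact: tot_connected.
- exact: max_degree_le.
- split; first by apply: le_lt_trans lam _; lra.
  have gap : 300^-1 * 300^-1 <= 1 - lambda2 (srw_mx R (tree_over_torus (2 ^ i.+2 - 2))).
    by rewrite lerBrDl -lerBrDr.
  rewrite ler_pdivrMr; last by apply: lt_le_trans gap; lra.
  by apply: le_trans (ler_wpM2l _ gap); lra.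
- by move=> dt dtl; apply: (@cover_time_ge i.+2).
Qed.
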